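(* Let $D=[-1,1]^2$ and let $f:D\to\mathbb{R}$ be a function such that for some integers $k,l\ge 0$ the partial derivative $f_{x^k y^l}$ is of bounded variation in the sense of Vitali on $D$ and the quantities $c_{i,j}^{(k+1,l+1)}$ ($i,j\ge 0$) are well defined. If $$V_{k,l}:=\int_{D}\left|f_{x^{k+1}y^{l+1}}(x,y)\right|\omega(x,y)\,dx\,dy<\infty ,\qquad \omega(x,y)=(1-x^2)^{-1/2}(1-y^2)^{-1/2},$$ then for all integers $i\ge k+1$ and $j\ge l+1$ the Chebyshev coefficients $c_{i,j}$ of $f$ satisfy $$|c_{i,j}|\le \frac{4V_{k,l}}{\pi^2}\begin{cases}\Gamma_{0,0}[s](i)\,\Gamma_{0,0}[r](j), & \text{if } k=2s,\ l=2r,\\ \Gamma_{0,0}[s](i)\,\Gamma_{1,-1}[r](j), & \text{if } k=2s,\ l=2r+1,\\ \Gamma_{1,-1}[s](i)\,\Gamma_{0,0}[r](j), & \text{if } k=2s+1,\ l=2r,\\ \Gamma_{1,-1}[s](i)\,\Gamma_{1,-1}[r](j), & \text{if } k=2s+1,\ l=2r+1,\end{cases}$$ where $s,r\ge 0$ are integers and $$\Gamma_{\alpha,\beta}[p](\eta)=\frac{1}{\prod_{n=-p}^{p+\alpha}(\eta+2n+\beta)} .$$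
   Context: $T_i(x)=\cos(i\arccos x)$ is the Chebyshev polynomial of degree $i$. The notation $f_{x^r y^s}$ means $\partial^{r+s}f/\partial x^r\partial y^s$. For integers $r,s\ge 0$ and $i,j\ge 0$, $$c_{i,j}^{(r,s)}=\frac{4}{\pi^2}\int_0^\pi\!\!\int_0^\pi f_{x^r y^s}(\cos\theta_x,\cos\theta_y)\cos(i\theta_x)\cos(j\theta_y)\,d\theta_x\,d\theta_y ,$$ and $c_{i,j}=c_{i,j}^{(0,0)}=\frac{4}{\pi^2}\int_D f(x,y)T_i(x)T_j(y)\omega(x,y)\,dx\,dy$ are the Chebyshev coefficients of $f$ (assumed to exist). A function $g:D\to\mathbb{R}$ is of bounded variation in the sense of Vitali if $\sup\sum_{p,q}|g(x_{p+1},y_{q+1})-g(x_{p+1},y_q)-g(x_p,y_{q+1})+g(x_p,y_q)|<\infty$, the supremum being over all grids $-1=x_0<\dots<x_P=1$, $-1=y_0<\dots<y_Q=1$. The integrals involving $f_{x^{k+1}y^{l+1}}$ are double Stieltjes integrals with respect to $f_{x^k y^l}$: $f_{x^{k+1}y^{l+1}}\,dx\,dy$ stands for the signed Stieltjes measure $d(f_{x^ky^l})$ on $D$ generated by the rectangular increments of $f_{x^k y^l}$, and $|f_{x^{k+1}y^{l+1}}|\,dx\,dy$ for its variation $|d(f_{x^ky^l})|$. Thus $V_{k,l}=\int_D\omega\,|d(f_{x^ky^l})|$ and $c_{i,j}^{(k+1,l+1)}=\frac{4}{\pi^2}\int_D T_i(x)T_j(y)\omega(x,y)\,d(f_{x^ky^l})$;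 when $f_{x^{k+1}y^{l+1}}$ is an ordinary integrable density these are the ordinary integrals. *)

(* Defs.v *)
From mathcomp Require Import all_boot all_order all_algebra.
From mathcomp Require Import all_classical all_reals all_analysis.
Import Order.TTheory GRing.Theory Num.Theory.
Import numFieldNormedType.Exports.

Set Implicit Arguments.
Unset Strict Implicit.
Unset Printing Implicit Defensive.

Local Open Scope classical_set_scope.
Local Open Scope ring_scope.

Notation plane R := (measurableTypeR R * measurableTypeR R)%type.

(* A function on D = [-1, 1]^2 is represented by a total [f : R -> R -> R].
   Derivatives are taken within [-1, 1] (hence one-sided at the endpoints) and
   increments are clamped to D, so values outside D play no role. *)

Definition diff_quot_in (R : realType) (g : R -> R) (x : R) :=
  (fun y => (g y - g x) / (y - x)) @ within `[-1, 1] x^'.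

Definition derivable_in (R : realType) (g : R -> R) (x : R) : Prop :=
  cvg (diff_quot_in g x).

Definition deriv_in (R : realType) (g : R -> R) (x : R) : R :=
  lim (diff_quot_in g x).

(* f_{x^r y^s} = d^r/dx^r (d^s f/dy^s) *)
Definition partial (R : realType) (f : R -> R -> R) (r s : nat) : R -> R -> R :=
  iter r (fun h x y => deriv_in (h ^~ y) x)
    (iter s (fun h x y => deriv_in (h x) y) f).

(* All the derivatives taken successively in forming f_{x^r y^s} exist at every
   point of D; no continuity or integrability is required. *)
Definition partial_exists (R : realType) (f : R -> R -> R) (r s : nat) : Prop :=
  (forall q, (q < s)%N -> {in `[-1, 1] &, forall x y : R,
     derivable_in (partial f 0 q x) y}) /\
  (forall p, (p < r)%N -> {in `[-1, 1] &, forall x y : R,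
     derivable_in (partial f p s ^~ y) x}).

Definition increment (R : realType) (g : R -> R -> R) (a b c d : R) : R :=
  g b d - g b c - g a d + g a c.

(* The grid points are those of [-1 :: s] and [-1 :: t]. *)
Definition vitali_variation (R : realType) (g : R -> R -> R) (s t : seq R) : R :=
  let x := nth 1 (-1 :: s) in
  let y := nth 1 (-1 :: t) in
  \sum_(0 <= p < size s) \sum_(0 <= q < size t)
    `|increment g (x p) (x p.+1) (y q) (y q.+1)|.

Definition vitali_bounded_variation (R : realType) (g : R -> R -> R) : Prop :=
  has_ubound [set v | exists s t : seq R,
    [/\ itv_partition (-1) 1 s, itv_partition (-1) 1 t
      & v = vitali_variation g s t]].

Definition clamp (R : realType) (x : R) : R := Num.max (-1) (Num.min x 1).

(* [mu] is the signed Stieltjes measure dg on D: extend g to the plane by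
   clamping; then mu (]a, b] x ]c, d]) is the increment of g over the rectangle.
   The limit t -> 0+ is the usual right regularization at jumps of g and may be
   dropped when g is right-continuous.  Clamping makes mu vanish outside D and
   charge a jump of g at an edge of D to that edge.  For g of bounded variation
   in the sense of Vitali such a mu exists, and it is unique since half-open
   rectangles form a generating pi-system. *)
Definition is_stieltjes_charge (R : realType) (g : R -> R -> R)
    (mu : {charge set (plane R) -> \bar R}) : Prop :=
  forall a b c d : R, a <= b -> c <= d ->
    increment (fun x y => g (clamp x) (clamp y)) (a + t) (b + t) (c + t) (d + t)
      @[t --> 0^'+] --> fine (mu (`]a, b] `*` `]c, d])).

Definition Dsquare (R : realType) : set (plane R) := `[-1, 1] `*` `[-1, 1].

Definition chebT (R : realType) (i : nat) (x : R) : R := cos (i%:R * acos x).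

(* Extended-real inverse, so that the weight is +oo on the boundary of D. *)
Definition omega (R : realType) (z : plane R) : \bar R :=
  ((Num.sqrt (1 - z.1 ^+ 2))%:E^-1 * (Num.sqrt (1 - z.2 ^+ 2))%:E^-1)%E.

Definition theta_domain (R : realType) : set (plane R) :=
  `[0, pi] `*` `[0, pi].

Definition cheb_integrand (R : realType) (f : R -> R -> R) (r s i j : nat)
    (th : plane R) : R :=
  partial f r s (cos th.1) (cos th.2) * cos (i%:R * th.1) * cos (j%:R * th.2).

Definition cheb_coef_exists (R : realType) (f : R -> R -> R) (r s i j : nat) :
    Prop :=
  (lebesgue_measure \x lebesgue_measure)%E.-integrable (@theta_domain R)
    (EFin \o cheb_integrand f r s i j).

(* c_{i,j}^{(r,s)}; the coefficients of f itself are those with r = s = 0. *)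
Definition cheb_coef (R : realType) (f : R -> R -> R) (r s i j : nat) : R :=
  4 / pi ^+ 2 * \int[(lebesgue_measure \x lebesgue_measure)%E]_(th in
    @theta_domain R) cheb_integrand f r s i j th.

(* The integral of T_i T_j omega against mu is well defined.  The variation of
   mu does not depend on the Hahn decomposition chosen to express it. *)
Definition stieltjes_coef_exists (R : realType)
    (mu : {charge set (plane R) -> \bar R}) (P N : set (plane R))
    (muPN : hahn_decomposition mu P N) (i j : nat) : Prop :=
  (charge_variation muPN).-integrable (@Dsquare R)
    (fun z => (chebT i z.1 * chebT j z.2)%:E * omega z)%E.

Definition weighted_variation (R : realType)
    (mu : {charge set (plane R) -> \bar R}) (P N : set (plane R))
    (muPN : hahn_decomposition mu P N) : \bar R :=
  (\int[charge_variation muPN]_(z in @Dsquare R) omega z)%E.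

(* Gamma_{alpha,beta}[p](eta), the index n = -p, ..., p + alpha being m - p. *)
Definition Gamma (R : realType) (alpha : nat) (beta : int) (p : nat) (eta : R) :
    R :=
  (\prod_(0 <= m < (2 * p + alpha).+1)
     (eta + 2 * (m%:Z - p%:Z)%:~R + beta%:~R))^-1.

(* Main.v *)
(** Put [J = leb \x leb], let [w(x) = (1 - x^2)^(-1/2)], and extend functions on
    the open square by [0].  Substituting [x = cos th], the combination
    [I i j - I i' j - I i j' + I i' j'] of the integrals defining the
    coefficients, with [i' = i + 2N] and [j' = j + 2N'], is the integral of [f]
    against [(T_i - T_i') w (x) (T_j - T_j') w].  Each factor is continuous and
    is, up to sign, the [(k+1)]-th, resp. [(l+1)]-th, derivative of a compactly
    supported function [phi], resp. [psi], which is bounded by a sum of two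
    reciprocal products [gam].

    Moving the derivatives onto [f] uses no integrability of the intermediate
    partial derivatives: one takes difference quotients, which are moved by
    translation invariance, and passes to the limit by dominated convergence,
    the mixed mean value theorem and the Vitali bound controlling the increments
    of [f_{x^k y^l}].  The last difference quotient in each variable turns into
    [mu] of a small cell, and Tonelli bounds the resulting integral by
    [sup |phi| * sup |psi| * |mu|(D)], where [|mu|(D) <= V] because [omega >= 1].

    Finally the three coefficients with [i'] or [j'] are removed by averaging
    over [N], then over [N']: Cesaro means of [cos ((i + 2N) th)] tend to [0]
    almost everywhere, and [gam] at [i'] tends to [0]. *)

Require Import Defs.
From HB Require Import structures.
From mathcomp Require Import all_boot all_order all_algebra.
From mathcomp Require Import all_classical all_reals all_analysis.
From mathcomp Require Import measurable_realfun ring lra.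
Import Order.TTheory GRing.Theory Num.Theory.
Import numFieldNormedType.Exports.
Local Open Scope classical_set_scope.
Local Open Scope ring_scope.

Set Implicit Arguments.
Unset Strict Implicit.
Unset Printing Implicit Defensive.

(** * Difference quotients and mean values *)

Section Differences.
Variable R : realType.
Implicit Types (F : nat -> R -> R) (h : R -> R) (a b d x y : R).

(** Two coefficients are subtracted because [T_i w] blows up at [-1] and [1]. The frequency [i + 2N]
    has the same parity as [i], so the difference of the cosines vanishes at both ends of [[0, pi]],
    and the top derivative of the test function becomes continuous and bounded on the whole line.
    The other obstacle is that variation in the sense of Vitali sees only rectangular increments:
    adding a function of [x] alone to [f_{x^k y^l}] changes none of them, so [f_{x^k y^l}] may be
    unbounded and is never integrated itself. Instead [f] is differenced once in each variable with
    a fixed step [e]; the mixed derivative of the result is an increment divided by [e^2], hence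
    bounded. Averaging the measure of a cell of side [e] over its position gives back the factor
    [e^2], so the final bound is independent of [e], and [e] may tend to [0]. Since the charge of a
    cell is only a limit of increments over cells shifted to the upper right, a further shift [h]
    tends to [0] before [e] does. *)

Definition chain a b n F :=
  forall q, (q < n)%N -> forall x, a < x < b -> is_derive x 1 (F q) (F q.+1 x).

Definition dq d h x := (h (x + d) - h x) / d.

(** Steps of difference quotients may have either sign, so [x] and [y] come in either order. The
    bound on [|c - x|] is kept for [iter_dq_cvg], where intermediate points must close in on [x]. *)
Lemma mean_value_between a b h dh x y :
  (forall z, a < z < b -> is_derive z 1 h (dh z)) ->
  a < x < b -> a < y < b ->
  exists c, [/\ a < c < b, `|c - x| <= `|y - x| & h y - h x = dh c * (y - x)].
Proof.
have main u v : u < v -> (forall z, a < z < b -> is_derive z 1 h (dh z)) ->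
    a < u < b -> a < v < b ->
    exists2 c, u < c < v & h v - h u = dh c * (v - u).
  move=> uv dF ua va.
  have [||c cI ->] := @MVT _ h dh u v uv.
  - by move=> w; rewrite in_itv/= => /andP[? ?]; apply: dF; lra.
  - apply: derivable_within_continuous => w; rewrite in_itv/= => /andP[? ?].
    have wab : a < w < b by lra.
    by case: (dF w wab).
  by exists c => //; move: cI; rewrite in_itv.
move=> dF xab yab; have [xy|yx|<-] := ltgtP x y.
- have [c /andP[c1 c2] E] := main x y xy dF xab yab; exists c; split=> //; first lra.
  by rewrite !ger0_norm ?subr_ge0 ?lerB// ltW.
- have [c /andP[c1 c2] E] := main y x yx dF yab xab; exists c; split; first lra.
    by rewrite !ler0_norm ?subr_le0 ?lerN2 ?lerB// ltW.
  by rewrite -opprB E; ring.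
- by exists x; split => //; rewrite !subrr mulr0.
Qed.

Lemma chain_dq a b n F d : d != 0 -> chain a b n F ->
  chain (Num.max a (a - d)) (Num.min b (b - d)) n (fun q => dq d (F q)).
Proof.
move=> d0 cF q qn x; rewrite gt_max lt_min => /andP[/andP[x1 x2] /andP[x3 x4]].
have D1 : is_derive x 1 (F q) (F q.+1 x) by apply: cF => //; rewrite x1 x3.
have D2 : is_derive (x + d) 1 (F q) (F q.+1 (x + d)).
  by apply: cF => //; apply/andP; split; lra.
have D3 : is_derive x 1 (F q \o shift d) (F q.+1 (x + d) * 1).
  exact: (@is_derive1_comp R (F q) (shift d) x _ _ D2 (is_derive_shift x 1 d)).
have := is_deriveZ d^-1 (is_deriveB D3 D1).
rewrite mulr1 /dq [X in is_derive _ _ X](_ : _ = fun z => (F q (z + d) - F q z) / d).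
  by rewrite /GRing.scale/= mulrC.
by apply/funext => z; rewrite fctE/= /GRing.scale/= mulrC.
Qed.

(** Induction on [n] through [chain_dq]: the inner quotients, applied to the chain of the
    [dq d (F q)], give a value of [dq d (F n)], and one mean value step turns it into a value of
    [F n.+1]. *)
Lemma iter_dq_mean_value a b n F d x : d != 0 -> chain a b n F ->
  a < x < b -> a < x + n%:R * d < b ->
  exists c, [/\ a < c < b, `|c - x| <= n%:R * `|d| &
    iter n (dq d) (F 0%N) x = F n c].
Proof.
move=> d0; elim: n F a b => [|n IH] F a b cF xab.
  by exists x; rewrite subrr normr0 mul0r.
rewrite -natr1 mulrDl mul1r => xnab.
(* [n d] and [d] have the same sign, so the intermediate nodes lie between [x] and the last one. *)
have dnd : (0 <= n%:R * d /\ 0 <= d) \/ (n%:R * d <= 0 /\ d <= 0).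
  have [|] := leP 0 d => h; [left|right]; split=> //.
    by rewrite mulr_ge0.
  by rewrite mulr_ge0_le0 // ltW.
  by rewrite ltW.
have cD : chain (Num.max a (a - d)) (Num.min b (b - d)) n (fun q => dq d (F q)).
  by apply: chain_dq => // q qn; apply: cF; rewrite ltnW.
have [||c [cab cx E]] := IH _ _ _ cD.
- by rewrite gt_max lt_min; apply/andP; split; apply/andP; split; lra.
- by rewrite gt_max lt_min; apply/andP; split; apply/andP; split; lra.
move: cab; rewrite gt_max lt_min => /andP[/andP[c1 c2] /andP[c3 c4]].
have [|||e [eab ec Ee]] := @mean_value_between a b (F n) (F n.+1) c (c + d).
- by move=> z zab; apply: cF.
- by rewrite c1.
- by apply/andP; split; lra.
exists e; split=> //.
  have -> : e - x = (e - c) + (c - x) by ring.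
  apply: le_trans (ler_normD _ _) _; rewrite mulrDl mul1r addrC lerD//.
  by apply: le_trans ec _; rewrite addrC addKr.
rewrite iterSr E /dq Ee [c + d]addrC addrK mulfK //.
Qed.

Lemma dq_cvg_derive h x D :
  is_derive x 1 h D <-> dq d h x @[d --> 0^'] --> D.
Proof.
have E : (fun d => d^-1 *: ((h \o shift x) (d *: 1) - h x)) = (fun d => dq d h x).
  by apply/funext => d /=; rewrite /GRing.scale/= mulr1 /dq mulrC [x + d]addrC.
split=> [[+ <-]|H].
  by rewrite /derivable /derive E.
split; first by rewrite /derivable E; apply/cvg_ex; exists D.
by rewrite /derive E; exact: cvg_lim.
Qed.

(** The last function may be discontinuous at [x], so its value at an intermediate point would not
    do. The mean value argument stops one order earlier, at a single quotient near [x], and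
    differentiability at [x] itself finishes. *)
Lemma iter_dq_cvg a b n F x : chain a b n F -> a < x < b ->
  iter n (dq d) (F 0%N) x @[d --> 0^'] --> F n x.
Proof.
case: n => [|n] cF xab; first exact: cvg_cst.
have Dx : is_derive x 1 (F n) (F n.+1 x) by apply: cF.
apply/cvgrPdist_le => e e0.
(* The nodes [c] and [c + d] will lie within [n |d|] and [n.+1 |d|] of [x]; with this constant their
   two linearization errors, divided by [|d|], add up to at most [e]. *)
have e'0 : 0 < e / (n%:R + n.+1%:R).
  by rewrite divr_gt0// ltr_wpDl// ltr0n.
have /cvgrPdist_le/(_ _ e'0) := (dq_cvg_derive _ _ _).1 Dx.
rewrite near_withinE => /nbhs_ballP[r /= r0 Hr].
have lin z : `|z| < r -> `|F n (x + z) - F n x - F n.+1 x * z| <=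
    e / (n%:R + n.+1%:R) * `|z|.
  have [->|z0] := eqVneq z 0; first by rewrite addr0 subrr mulr0 subr0 normr0 mulr0.
  move=> zr; have := Hr z _ z0; rewrite /ball/= sub0r normrN => /(_ zr).
  rewrite /dq distrC => H.
  have -> : F n (x + z) - F n x - F n.+1 x * z =
      ((F n (x + z) - F n x) / z - F n.+1 x) * z.
    by rewrite mulrBl divfK.
  by rewrite normrM ler_wpM2r.
pose m : R := Num.min (x - a) (b - x).
have m0 : 0 < m by rewrite lt_min; lra.
rewrite near_withinE; apply/nbhs_ballP; exists (Num.min r m / n.+1%:R) => /=.
  by rewrite divr_gt0// lt_min r0.
move=> d; rewrite /ball/= sub0r normrN ltr_pdivlMr// mulrC => dr d0.
have [dr1 dm] : n.+1%:R * `|d| < r /\ n.+1%:R * `|d| < m.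
  by move: dr; rewrite lt_min => /andP[].
have cD : chain (Num.max a (a - d)) (Num.min b (b - d)) n (fun q => dq d (F q)).
  by apply: chain_dq => // q qn; apply: cF; rewrite ltnW.
have nd : `|n%:R * d| + `|d| = n.+1%:R * `|d|.
  by rewrite normrM -natr1 mulrDl mul1r ger0_norm.
have [dm1 dm2] : `|n%:R * d| + `|d| < x - a /\ `|n%:R * d| + `|d| < b - x.
  by move: dm; rewrite nd lt_min => /andP[].
have {dm} : `|n%:R * d| >= 0 by [].
have := ler_norm d; have := ler_norm (- d); have := ler_norm (n%:R * d).
have := ler_norm (- (n%:R * d)); rewrite !normrN => h1 h2 h3 h4 h5.
rewrite -iterS iterSr.
have [||c [cab cx ->]] := iter_dq_mean_value (x := x) d0 cD.
- by rewrite gt_max lt_min; apply/andP; split; apply/andP; split; lra.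
- by rewrite gt_max lt_min; apply/andP; split; apply/andP; split; lra.
have -> : F n.+1 x - dq d (F n) c =
    ((F n (x + (c - x)) - F n x - F n.+1 x * (c - x)) -
     (F n (x + (c - x + d)) - F n x - F n.+1 x * (c - x + d))) / d.
  have -> : x + (c - x) = c by ring.
  have -> : x + (c - x + d) = c + d by ring.
  by rewrite /dq; field.
rewrite normrM normfV ler_pdivrMr ?normr_gt0//.
have cxd : `|c - x| <= `|n%:R * d| by rewrite normrM ger0_norm.
have cdd := ler_normD (c - x) d.
apply: le_trans (ler_normB _ _) _.
have L1 := @lin (c - x); have L2 := @lin (c - x + d).
apply: le_trans (lerD (L1 _) (L2 _)) _; [by rewrite -nd in dr1; lra..|].
rewrite -mulrDr -mulrA ler_pM2l// ler_pdivrMl; last by rewrite ltr_wpDl// ltr0n.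
have -> : (n%:R + n.+1%:R) * `|d| = `|n%:R * d| + (`|n%:R * d| + `|d|).
  by rewrite nd mulrDl normrM ger0_norm.
by lra.
Qed.

Definition dq1 d (G : R -> R -> R) x y := dq d (G ^~ y) x.
Definition dq2 d (G : R -> R -> R) x y := dq d (G x) y.

Lemma dq1_dq2C d d' G : dq1 d (dq2 d' G) = dq2 d' (dq1 d G).
Proof.
by apply/funext => x; apply/funext => y; rewrite /dq1 /dq2 /dq; ring.
Qed.

Lemma iter_dq1E n d G x y : iter n (dq1 d) G x y = iter n (dq d) (G ^~ y) x.
Proof.
elim: n x => //= n IH x; rewrite /dq1; congr (dq d _ x).
by apply/funext => z; rewrite IH.
Qed.

Lemma iter_dq2E n d G x y : iter n (dq2 d) G x y = iter n (dq d) (G x) y.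
Proof.
elim: n y => //= n IH y; rewrite /dq2; congr (dq d _ y).
by apply/funext => z; rewrite IH.
Qed.

Lemma iter_dq1_dq2C k l d d' G :
  iter k (dq1 d) (iter l (dq2 d') G) = iter l (dq2 d') (iter k (dq1 d) G).
Proof.
elim: k => //= k ->; elim: l (iter k _ _) => //= l IH H.
by rewrite dq1_dq2C IH.
Qed.

Lemma chain_dqB a b n F G d : chain a b n F -> chain a b n G ->
  chain a b n (fun q x => (F q x - G q x) / d).
Proof.
move=> cF cG q qn x xab; have D1 := cF q qn x xab; have D2 := cG q qn x xab.
have := is_deriveZ d^-1 (is_deriveB D1 D2).
rewrite [X in is_derive _ _ X](_ : _ = fun z => (F q z - G q z) / d).
  by rewrite /GRing.scale/= mulrC.
by apply/funext => z; rewrite fctE/= /GRing.scale/= mulrC.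
Qed.

Lemma itv_step a b (n : nat) x d : a < x < b -> a < x + n.+1%:R * d < b ->
  [/\ a < x + d < b, a < x + n%:R * d < b & a < x + d + n%:R * d < b].
Proof.
rewrite -natr1 mulrDl mul1r => xab yab.
suff : (0 <= n%:R * d /\ 0 <= d) \/ (n%:R * d <= 0 /\ d <= 0).
  by case=> -[? ?]; split; apply/andP; split; lra.
have [d0|d0] := leP 0 d; [left|right]; split=> //.
- by rewrite mulr_ge0.
- by rewrite mulr_ge0_le0 // ltW.
- by rewrite ltW.
Qed.

(** Differencing in [x] combines finitely many sections linearly, which commutes with
    differentiation in [y]. *)
Lemma chain_iter_dq1 a b k l (G : nat -> R -> R -> R) d x :
  (forall x, a < x < b -> chain a b l (fun q => G q x)) ->
  a < x < b -> a < x + k%:R * d < b ->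
  chain a b l (fun q => iter k (dq1 d) (G q) x).
Proof.
move=> cG; elim: k x => [|k IH] x xab ykab; first exact: cG.
have [h1 h2 h3] := itv_step xab ykab.
have C1 := IH _ h1 h3; have C2 := IH _ xab h2.
exact: chain_dqB C1 C2.
Qed.

Section Mixed.
Variables (a b : R) (k l : nat) (G W : nat -> R -> R -> R).
Hypothesis cG : forall x, a < x < b -> chain a b l (fun q => G q x).
Hypothesis cW : forall y, a < y < b -> chain a b k (fun p => W p ^~ y).
Hypothesis GW : G l = W 0%N.

(** The quotients commute. Those in [y] are resolved first, on the whole combination of sections,
    which yields one ordinate [v] common to all of them; those in [x] are then resolved at that
    [v]. *)
Lemma mixed_mean_value d d' x y : d != 0 -> d' != 0 ->
  a < x < b -> a < x + k%:R * d < b ->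
  a < y < b -> a < y + l%:R * d' < b ->
  exists u v, [/\ a < u < b, a < v < b &
    iter k (dq1 d) (iter l (dq2 d') (G 0%N)) x y = W k u v].
Proof.
move=> d0 d'0 xab xkab yab ylab; rewrite iter_dq1_dq2C iter_dq2E.
have cH := chain_iter_dq1 cG xab xkab.
have [v [vab _ ->]] := iter_dq_mean_value d'0 cH yab ylab.
rewrite iter_dq1E GW.
have [u [uab _ ->]] := iter_dq_mean_value d0 (cW vab) xab xkab.
by exists u, v.
Qed.

(** Only iterated derivatives exist, so the limits are taken one at a time, [d'] before [d], in the
    order in which [partial] differentiates. *)
Lemma mixed_cvg2 d x y : a < x < b -> a < x + k%:R * d < b -> a < y < b ->
  iter k (dq1 d) (iter l (dq2 d') (G 0%N)) x y @[d' --> 0^'] -->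
  iter k (dq1 d) (W 0%N) x y.
Proof.
move=> xab xkab yab; have cH := chain_iter_dq1 cG xab xkab.
rewrite -GW; under eq_fun do rewrite iter_dq1_dq2C iter_dq2E.
exact: (iter_dq_cvg cH yab).
Qed.

Lemma mixed_cvg1 x y : a < x < b -> a < y < b ->
  iter k (dq1 d) (W 0%N) x y @[d --> 0^'] --> W k x y.
Proof.
move=> xab yab; under eq_fun do rewrite iter_dq1E.
exact: (iter_dq_cvg (cW yab) xab).
Qed.

End Mixed.

End Differences.

(** * Integration on the plane *)

Section DominatedConvergence.
Context d (T : measurableType d) (R : realType).
Variables (mu : {measure set T -> \bar R}) (D : set T) (mD : measurable D).

Lemma dominated_cvg_Rintegral (f_ : nat -> T -> R) (f g : T -> R) :
  (forall n, measurable_fun D (f_ n)) ->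
  (forall x, D x -> f_ n x @[n --> \oo] --> f x) ->
  mu.-integrable D (EFin \o g) ->
  (forall n x, D x -> `|f_ n x| <= g x) ->
  mu.-integrable D (EFin \o f) /\
  \int[mu]_(x in D) f_ n x @[n --> \oo] --> \int[mu]_(x in D) f x.
Proof.
move=> mf cf ig fg.
have mf' : measurable_fun D f by exact: (@measurable_fun_cvg _ _ _ D f_).
have [|||||h1 _ h2] := @dominated_convergence _ _ _ mu D mD
  (fun n => EFin \o f_ n) (EFin \o f) (EFin \o g) => //.
- by move=> n; exact/measurable_EFinP.
- exact/measurable_EFinP.
- by apply: aeW => x Dx; apply: cvg_EFin; [exact: nearW|exact: cf].
- by apply: aeW => x n Dx /=; rewrite lee_fin fg.
split=> //; apply: fine_cvg; rewrite fineK//.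
by apply: integrable_fin_num.
Qed.

End DominatedConvergence.

(** * Translation invariance of Lebesgue measure on the plane *)

Section Translation.
Variable R : realType.
Notation leb := (@lebesgue_measure R).
Notation J := (leb \x leb)%E.
Implicit Types (F G : plane R -> R).

Lemma measurable_translation (a : R) :
  measurable_fun setT (fun x : measurableTypeR R => x + a : measurableTypeR R).
Proof. exact: measurable_funD. Qed.

Lemma lebesgue_measure_translation (a : R) (A : set (measurableTypeR R)) :
  measurable A ->
  leb ((fun x : measurableTypeR R => x + a : measurableTypeR R) @^-1` A) = leb A.
Proof.
move=> mA; apply/esym; rewrite -[RHS]/(pushforward leb _ A).
apply: lebesgue_measure_unique => //=; first exact: measurable_translation.
move=> mf _ [[u v]] _ <- /=; rewrite /pushforward.
have -> : (fun x => x + a) @^-1` `]u, v] = `]u - a, v - a]%classic.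
  by apply/seteqP; split=> x /=; rewrite !in_itv/= ltrBlDr lerBrDr.
rewrite !lebesgue_measure_itv/= !lte_fin ltrD2r.
by rewrite -!EFinB opprD addrACA subrr addr0.
Qed.

Definition shift2 (a b : R) (z : plane R) : plane R := (z.1 + a, z.2 + b).

Lemma measurable_shift2 a b : measurable_fun setT (shift2 a b).
Proof.
apply/measurable_fun_pairP; split.
  exact: (measurableT_comp (measurable_translation a)) measurable_fst.
exact: (measurableT_comp (measurable_translation b)) measurable_snd.
Qed.

Lemma lebesgue_measure2_shift a b (A : set (plane R)) : measurable A ->
  J A = pushforward J (shift2 a b) A.
Proof.
apply: product_measure_unique; first exact: measurable_shift2.
move=> mf B C mB mC; rewrite /= /pushforward.
have -> : shift2 a b @^-1` (B `*` C) = ((fun x => x + a) @^-1` B) `*` ((fun x => x + b) @^-1` C).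
  by [].
rewrite product_measure1E.
- by congr (_ * _)%E; exact: lebesgue_measure_translation.
- by rewrite -[X in measurable X]setTI; exact: measurable_translation.
- by rewrite -[X in measurable X]setTI; exact: measurable_translation.
Qed.

Lemma integrable_shift2 F a b : J.-integrable setT (EFin \o F) ->
  J.-integrable setT (EFin \o (F \o shift2 a b)).
Proof.
move=> /integrableP[mF iF]; apply/integrableP; split.
  exact: measurableT_comp mF (measurable_shift2 a b).
apply: le_lt_trans iF; rewrite le_eqVlt; apply/orP; left; apply/eqP.
transitivity (\int[pushforward J (shift2 a b)]_x `|(EFin \o F) x|)%E.
  rewrite ge0_integral_pushforward//.
    exact: measurable_shift2.
  exact: measurableT_comp.
apply: eq_measure_integral; first exact: measurable_shift2.
by move=> mf A mA _; apply/esym/lebesgue_measure2_shift.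
Qed.

Lemma Rintegral_shift2 F a b : J.-integrable setT (EFin \o F) ->
  \int[J]_z F (shift2 a b z) = \int[J]_z F z.
Proof.
move=> iF; congr fine.
transitivity (\int[pushforward J (shift2 a b)]_x ((EFin \o F) x))%E.
  rewrite integral_pushforward//.
  - exact: measurable_shift2.
  - exact: measurable_int iF.
  - exact: integrable_shift2.
apply: eq_measure_integral; first exact: measurable_shift2.
by move=> mf A mA _; apply/esym/lebesgue_measure2_shift.
Qed.

End Translation.

(** * Moving difference quotients onto tensor products *)

Section Adjoint.
Variable R : realType.
Notation leb := (@lebesgue_measure R).
Notation J := (leb \x leb)%E.

Definition bounded_measurable (u : R -> R) :=
  measurable_fun setT u /\ exists C, forall x, `|u x| <= C.

Definition uncurry2 (G : R -> R -> R) (z : plane R) : R := G z.1 z.2.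

Definition tens (u v : R -> R) (z : plane R) : R := u z.1 * v z.2.

Lemma bounded_measurable_bound u : bounded_measurable u ->
  exists2 C, 0 < C & forall x, `|u x| <= C.
Proof.
move=> [_ [C uC]]; exists (C + 1) => [|x]; last by rewrite ler_wpDr.
by rewrite ltr_wpDl// (le_trans _ (uC 0)).
Qed.

Lemma bounded_measurable_dq d u : bounded_measurable u ->
  bounded_measurable (dq d u).
Proof.
move=> bu; have [mu _] := bu; have [C C0 uC] := bounded_measurable_bound bu.
split.
  apply: measurable_funM; last exact: measurable_cst.
  apply: measurable_funB => //.
  exact: (measurableT_comp mu (measurable_translation d)).
exists ((C + C) * `|d|^-1) => x; rewrite /dq normrM normfV ler_wpM2r ?invr_ge0//.
by rewrite (le_trans (ler_normB _ _))// lerD.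
Qed.

Lemma bounded_measurable_iter_dq n d u : bounded_measurable u ->
  bounded_measurable (iter n (dq d) u).
Proof. by move=> bu; elim: n => //= n; exact: bounded_measurable_dq. Qed.

Lemma measurable_tens u v : bounded_measurable u -> bounded_measurable v ->
  measurable_fun setT (tens u v).
Proof.
move=> [mu _] [mv _]; apply: measurable_funM.
  exact: measurableT_comp mu measurable_fst.
exact: measurableT_comp mv measurable_snd.
Qed.

Lemma integrable_mul_tens (F : plane R -> R) u v :
  J.-integrable setT (EFin \o F) ->
  bounded_measurable u -> bounded_measurable v ->
  J.-integrable setT (EFin \o (fun z => F z * tens u v z)).
Proof.
move=> iF bu bv.
have [C C0 uC] := bounded_measurable_bound bu.
have [C' C'0 vC] := bounded_measurable_bound bv.
apply: (@le_integrable _ _ _ J setT measurableT _ (fun z => (C * C')%:E * (EFin \o F) z)%E) => //.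
- apply/measurable_EFinP/measurable_funM; last exact: measurable_tens.
  by apply/measurable_EFinP; exact: measurable_int iF.
- move=> z _ /=; rewrite lee_fin !normrM mulrC ler_wpM2r//.
  by rewrite [`|C|]gtr0_norm// [`|C'|]gtr0_norm// ler_pM.
- exact: integrableZl.
Qed.

Lemma bounded_measurable_shift u d : bounded_measurable u ->
  bounded_measurable (fun x => u (x + d)).
Proof.
case=> mu [C uC]; split; last by exists C.
exact: (measurableT_comp mu (measurable_translation d)).
Qed.

Lemma Rintegral_shift2_tens (F : plane R -> R) a b u v :
  J.-integrable setT (EFin \o F) ->
  bounded_measurable u -> bounded_measurable v ->
  \int[J]_z (F (shift2 a b z) * tens u v z) =
  \int[J]_z (F z * tens (fun x => u (x - a)) (fun y => v (y - b)) z).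
Proof.
move=> iF bu bv.
have i3 := integrable_mul_tens iF (bounded_measurable_shift (- a) bu)
  (bounded_measurable_shift (- b) bv).
rewrite -(Rintegral_shift2 a b i3); apply: eq_Rintegral => z _.
by rewrite /tens /= !addrK.
Qed.

(* Summation by parts for difference quotients, from translation invariance. *)
Lemma adjoint_shift2 d a b (G H : plane R -> R) u v u' v' :
  J.-integrable setT (EFin \o G) ->
  bounded_measurable u -> bounded_measurable v ->
  bounded_measurable u' -> bounded_measurable v' ->
  (forall z, H z = (G (shift2 a b z) - G z) / d) ->
  (forall z, - tens u' v' z =
    (tens (fun x => u (x - a)) (fun y => v (y - b)) z - tens u v z) / d) ->
  J.-integrable setT (EFin \o H) /\
  \int[J]_z (H z * tens u v z) = - \int[J]_z (G z * tens u' v' z).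
Proof.
move=> iG bu bv bu' bv' HE uv'.
have iGd := integrable_shift2 a b iG.
have E1 : H = (fun z => d^-1 * (G (shift2 a b z) - G z)).
  by apply/funext => z; rewrite HE mulrC.
have iB : J.-integrable setT (EFin \o (fun z => G (shift2 a b z) - G z)).
  exact: (integrableB measurableT iGd iG).
split; first by rewrite E1; exact: (integrableZl measurableT d^-1 iB).
have i1 := integrable_mul_tens iGd bu bv.
have i2 := integrable_mul_tens iG bu bv.
have i3 := integrable_mul_tens iG (bounded_measurable_shift (- a) bu)
  (bounded_measurable_shift (- b) bv).
transitivity (d^-1 * (\int[J]_z (G (shift2 a b z) * tens u v z) -
                      \int[J]_z (G z * tens u v z))).
  rewrite -RintegralB// -RintegralZl//; last exact: (integrableB measurableT i1 i2).
  by apply: eq_Rintegral => z _; rewrite E1 -mulrA -mulrBl.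
rewrite Rintegral_shift2_tens// -RintegralB// -RintegralZl//; last first.
  exact: (integrableB measurableT i3 i2).
rewrite -[RHS]mulN1r -RintegralZl//; last exact: integrable_mul_tens.
by apply: eq_Rintegral => z _; rewrite [RHS]mulN1r -[RHS]mulrN uv' -mulrBr; ring.
Qed.

Lemma adjoint_dq1 d G u v : J.-integrable setT (EFin \o uncurry2 G) ->
  bounded_measurable u -> bounded_measurable v ->
  J.-integrable setT (EFin \o uncurry2 (dq1 d G)) /\
  \int[J]_z (uncurry2 (dq1 d G) z * tens u v z) =
  - \int[J]_z (uncurry2 G z * tens (dq (- d) u) v z).
Proof.
move=> iG bu bv; apply: (@adjoint_shift2 d d 0) => //.
- exact: bounded_measurable_dq.
- by move=> z; rewrite /uncurry2 /dq1 /dq/= addr0.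
- by move=> z; rewrite /tens /dq subr0 invrN; ring.
Qed.

Lemma adjoint_dq2 d G u v : J.-integrable setT (EFin \o uncurry2 G) ->
  bounded_measurable u -> bounded_measurable v ->
  J.-integrable setT (EFin \o uncurry2 (dq2 d G)) /\
  \int[J]_z (uncurry2 (dq2 d G) z * tens u v z) =
  - \int[J]_z (uncurry2 G z * tens u (dq (- d) v) z).
Proof.
move=> iG bu bv; apply: (@adjoint_shift2 d 0 d) => //.
- exact: bounded_measurable_dq.
- by move=> z; rewrite /uncurry2 /dq2 /dq/= addr0.
- by move=> z; rewrite /tens /dq subr0 invrN; ring.
Qed.

Lemma adjoint_iter_dq1 k d G u v : J.-integrable setT (EFin \o uncurry2 G) ->
  bounded_measurable u -> bounded_measurable v ->
  J.-integrable setT (EFin \o uncurry2 (iter k (dq1 d) G)) /\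
  \int[J]_z (uncurry2 (iter k (dq1 d) G) z * tens u v z) =
  (-1) ^+ k * \int[J]_z (uncurry2 G z * tens (iter k (dq (- d)) u) v z).
Proof.
move=> iG; elim: k u => [|k IH] u bu bv; first by rewrite mul1r.
have [iGk E] := IH _ (bounded_measurable_dq (- d) bu) bv.
have [h1 h2] := adjoint_dq1 d iGk bu bv; split=> //.
by rewrite h2 E exprS mulN1r mulNr -iterSr.
Qed.

Lemma adjoint_iter_dq2 k d G u v : J.-integrable setT (EFin \o uncurry2 G) ->
  bounded_measurable u -> bounded_measurable v ->
  J.-integrable setT (EFin \o uncurry2 (iter k (dq2 d) G)) /\
  \int[J]_z (uncurry2 (iter k (dq2 d) G) z * tens u v z) =
  (-1) ^+ k * \int[J]_z (uncurry2 G z * tens u (iter k (dq (- d)) v) z).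
Proof.
move=> iG; elim: k v => [|k IH] v bu bv; first by rewrite mul1r.
have [iGk E] := IH _ bu (bounded_measurable_dq (- d) bv).
have [h1 h2] := adjoint_dq2 d iGk bu bv; split=> //.
by rewrite h2 E exprS mulN1r mulNr -iterSr.
Qed.

Lemma adjoint_mixed k l d d' G u v : J.-integrable setT (EFin \o uncurry2 G) ->
  bounded_measurable u -> bounded_measurable v ->
  J.-integrable setT (EFin \o uncurry2 (iter k (dq1 d) (iter l (dq2 d') G))) /\
  \int[J]_z (uncurry2 (iter k (dq1 d) (iter l (dq2 d') G)) z * tens u v z) =
  (-1) ^+ (k + l) * \int[J]_z (uncurry2 G z *
     tens (iter k (dq (- d)) u) (iter l (dq (- d')) v) z).
Proof.
move=> iG bu bv.
have bu' := bounded_measurable_iter_dq k (- d) bu.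
have [h1 h2] := adjoint_iter_dq2 l d' iG bu' bv.
have [h3 h4] := adjoint_iter_dq1 k d h1 bu bv.
by split=> //; rewrite h4 h2 exprD mulrA.
Qed.

End Adjoint.

(** * Test functions and weak derivatives *)

Section TestFunctions.
Variable R : realType.
Notation leb := (@lebesgue_measure R).
Notation J := (leb \x leb)%E.
Implicit Types (phi psi : nat -> R -> R) (s t : R).

(* [phi q] is the [q]-th derivative of [phi 0]. *)
Record test_chain n s t phi : Prop := TestChain {
  test_derive : forall q, (q < n)%N -> forall x : R, is_derive x 1 (phi q) (phi q.+1 x) ;
  test_continuous : forall q, (q <= n)%N -> continuous (phi q) ;
  test_support : forall q, (q <= n)%N -> forall x : R, ~~ (s <= x <= t) -> phi q x = 0 }.

Lemma test_bounded n s t phi q : test_chain n s t phi -> (q <= n)%N ->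
  bounded_measurable (phi q).
Proof.
move=> [_ cphi sphi] qn; split.
  by apply: continuous_measurable_fun; exact: cphi.
have [st|ts] := leP s t; last first.
  by exists 0 => x; rewrite (sphi _ qn) ?normr0//; apply/negP; lra.
have [|c cst Hc] := @EVT_max R (fun x => `|phi q x|) s t st.
  apply: continuous_subspaceT => x.
  by apply: continuous_comp; [exact: cphi|exact: norm_continuous].
exists `|phi q c| => x.
have [xst|xst] := boolP (s <= x <= t); last by rewrite (sphi _ qn)// normr0.
by apply: Hc; rewrite in_itv.
Qed.

(** The iterated quotient is a value of [phi q]. Uniformity in [d] is what domination requires. *)
Lemma test_iter_dq_bound n s t phi q d C x : test_chain n s t phi -> (q <= n)%N ->
  d != 0 -> (forall x, `|phi q x| <= C) -> `|iter q (dq d) (phi 0%N) x| <= C.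
Proof.
move=> T qn d0 phiC; set e := 1 + `|q%:R * d|.
have h1 := ler_norm (q%:R * d); have h2 := ler_norm (- (q%:R * d)).
rewrite normrN in h2.
have cT : chain (x - e) (x + e) q phi.
  by move=> p pq z _; apply: (test_derive T); exact: leq_trans pq qn.
have [||c [_ _ ->]] := iter_dq_mean_value (x := x) d0 cT => //.
- by apply/andP; split; rewrite /e; lra.
- by apply/andP; split; rewrite /e; lra.
Qed.

Lemma test_iter_dq_cvg n s t phi q x : test_chain n s t phi -> (q <= n)%N ->
  iter q (dq d) (phi 0%N) x @[d --> 0^'] --> phi q x.
Proof.
move=> T qn; apply: (@iter_dq_cvg R (x - 1) (x + 1)); last by lra.
by move=> p pq z _; apply: (test_derive T); exact: leq_trans pq qn.
Qed.

Lemma test_shift n s t phi e : test_chain n s t phi ->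
  test_chain n (s + e) (t + e) (fun q x => phi q (x - e)).
Proof.
move=> [dp cp sp]; split.
- move=> q qn x.
  have D := dp q qn (x - e).
  have := @is_derive1_comp R (phi q) (shift (- e)) x _ _ D (is_derive_shift x 1 (- e)).
  by rewrite mulr1.
- move=> q qn x; apply: (@continuous_comp _ _ _ (fun x => x - e) (phi q)).
    by apply: continuousB; [exact: cvg_id|exact: cvg_cst].
  exact: cp.
- by move=> q qn x xst; apply: sp => //; apply: contra xst => /andP[? ?]; apply/andP; split; lra.
Qed.

Lemma test_tail n m s t phi : test_chain (m + n) s t phi ->
  test_chain n s t (fun q => phi (m + q)%N).
Proof.
move=> [dp cp sp]; split.
- by move=> q qn x; rewrite addnS; apply: dp; rewrite ltn_add2l.
- by move=> q qn; apply: cp; rewrite leq_add2l.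
- by move=> q qn; apply: sp; rewrite leq_add2l.
Qed.

Lemma test_le n m s t phi : (m <= n)%N -> test_chain n s t phi ->
  test_chain m s t phi.
Proof.
move=> mn [dp cp sp]; split => q qm.
- by apply: dp; exact: leq_trans mn.
- by apply: cp; exact: leq_trans mn.
- by apply: sp; exact: leq_trans mn.
Qed.

Lemma integrable_tens_test n m s t phi psi p q :
  test_chain n s t phi -> test_chain m s t psi -> (p <= n)%N -> (q <= m)%N ->
  J.-integrable setT (EFin \o tens (phi p) (psi q)).
Proof.
move=> T T' pn qm.
set B : set (plane R) := `[s, t] `*` `[s, t].
have mB : measurable B by apply: measurableX; exact: measurable_itv.
have JB : (J B < +oo)%E.
  have -> : J B = (leb `[s, t]%classic * leb `[s, t]%classic)%E.
    by apply: product_measure1E; exact: measurable_itv.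
  rewrite !lebesgue_measure_itv/=; case: ifPn => _; last by rewrite mule0.
  by rewrite -EFinB -EFinM ltry.
have i1 : J.-integrable setT (EFin \o \1_B).
  apply/integrableP; split; first exact/measurable_EFinP.
  under eq_integral do rewrite gee0_abs ?lee_fin//.
  by rewrite integral_indic// setIT.
have := integrable_mul_tens i1 (test_bounded T pn) (test_bounded T' qm).
congr (J.-integrable _ _); apply/funext => z /=; congr EFin.
rewrite indicE; have [zB|zB] := boolP (z \in B); first by rewrite mul1r.
rewrite mul0r /tens; move: zB; rewrite notin_setE /B /= !in_itv/= => zB.
have [z1|z1] := boolP (s <= z.1 <= t); last by rewrite (test_support T)// mul0r.
have [z2|z2] := boolP (s <= z.2 <= t); last by rewrite (test_support T')// mulr0.
by case: zB.
Qed.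

End TestFunctions.

Section Sequences.
Variable R : realType.

Lemma cvg_step (e : R) : e / n.+1%:R @[n --> \oo] --> (0 : R).
Proof.
have -> : (fun n : nat => e / n.+1%:R) = (fun n : nat => e * harmonic n) by [].
by rewrite -[X in _ --> X](mulr0 e); apply: cvgMr; exact: cvg_harmonic.
Qed.

Lemma dnbhs_step (e : R) (f : R -> R) (l : R) : 0 < e ->
  f x @[x --> 0^'] --> l -> f (e / n.+1%:R) @[n --> \oo] --> l.
Proof.
move=> e0 /cvg_dnbhs_at_right/cvg_at_rightP; apply; split; last exact: cvg_step.
by move=> n; rewrite divr_gt0.
Qed.

(** Duality turns a step [d] into [- d], so test functions are differenced with negative steps. *)
Lemma dnbhs_stepN (e : R) (f : R -> R) (l : R) : 0 < e ->
  f x @[x --> 0^'] --> l -> f (- (e / n.+1%:R)) @[n --> \oo] --> l.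
Proof.
move=> e0 /cvg_dnbhs_at_left/cvg_at_leftP; apply; split.
  by move=> n; rewrite oppr_lt0 divr_gt0.
by rewrite -oppr0; apply: cvgN; exact: cvg_step.
Qed.

End Sequences.

Section PlaneIntegrals.
Variable R : realType.
Notation leb := (@lebesgue_measure R).
Notation J := (leb \x leb)%E.
Implicit Types F g : plane R -> R.

Lemma integrable_plane_measurable F : J.-integrable setT (EFin \o F) ->
  measurable_fun setT F.
Proof. by move=> iF; apply/measurable_EFinP; exact: measurable_int iF. Qed.

Lemma integrable_plane_Zl c F : J.-integrable setT (EFin \o F) ->
  J.-integrable setT (EFin \o (fun z => c * F z)).
Proof. by move=> iF; exact: (integrableZl measurableT c iF). Qed.

Lemma integrable_plane_norm F : J.-integrable setT (EFin \o F) ->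
  J.-integrable setT (EFin \o (fun z => `|F z|)).
Proof. by move=> iF; exact: (integrable_norm (mu := J)). Qed.

Lemma dominated_cvg_plane (F_ : nat -> plane R -> R) F g :
  (forall n, measurable_fun setT (F_ n)) ->
  (forall z, F_ n z @[n --> \oo] --> F z) ->
  J.-integrable setT (EFin \o g) ->
  (forall n z, `|F_ n z| <= g z) ->
  J.-integrable setT (EFin \o F) /\
  \int[J]_z F_ n z @[n --> \oo] --> \int[J]_z F z.
Proof.
move=> mF cF ig Fg.
have := @dominated_cvg_Rintegral _ (plane R) R J setT measurableT F_ F g.
by apply=> //; move=> n z _; exact: Fg.
Qed.

Lemma Rintegral_mul_tens_cvg F (u_ v_ : nat -> R -> R) u v :
  J.-integrable setT (EFin \o F) ->
  (forall n, bounded_measurable (u_ n)) -> (forall n, bounded_measurable (v_ n)) ->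
  (exists C, forall n x, `|u_ n x| <= C) -> (exists C, forall n x, `|v_ n x| <= C) ->
  (forall x, u_ n x @[n --> \oo] --> u x) -> (forall x, v_ n x @[n --> \oo] --> v x) ->
  \int[J]_z (F z * tens (u_ n) (v_ n) z) @[n --> \oo] -->
  \int[J]_z (F z * tens u v z).
Proof.
move=> iF bu bv [C uC] [C' vC] cu cv.
apply: (proj2 (@dominated_cvg_plane _ _ (fun z => (C * C') * `|F z|) _ _ _ _)) => //.
- by move=> n; apply: integrable_plane_measurable; exact: integrable_mul_tens.
- by move=> z; apply: cvgMr; apply: cvgM.
- exact/integrable_plane_Zl/integrable_plane_norm.
- by move=> n z; rewrite normrM mulrC ler_wpM2r// normrM ler_pM.
Qed.

End PlaneIntegrals.

Section TensorSupport.
Variables (R : realType) (s t : R) (n m : nat) (phi psi : nat -> R -> R).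
Hypothesis Tphi : test_chain n s t phi.
Hypothesis Tpsi : test_chain m s t psi.

(** Off the support square both sides are [0], so [u] has to converge only where difference
    quotients stay inside the domain. *)
Lemma tens_support_cvg (u : nat -> R) z (r : R) :
  (s <= z.1 <= t -> s <= z.2 <= t -> u n @[n --> \oo] --> r) ->
  u n * tens (phi 0%N) (psi 0%N) z @[n --> \oo] --> r * tens (phi 0%N) (psi 0%N) z.
Proof.
move=> H; have [z1|z1] := boolP (s <= z.1 <= t); last first.
  rewrite /tens (test_support Tphi)// mul0r mulr0; under eq_fun do rewrite mulr0.
  exact: cvg_cst.
have [z2|z2] := boolP (s <= z.2 <= t); last first.
  rewrite /tens (test_support Tpsi)// !mulr0; under eq_fun do rewrite mulr0.
  exact: cvg_cst.
by apply: cvgMl; exact: H.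
Qed.

Lemma tens_support_le z (r C : R) : (s <= z.1 <= t -> s <= z.2 <= t -> `|r| <= C) ->
  `|r * tens (phi 0%N) (psi 0%N) z| <= C * `|tens (phi 0%N) (psi 0%N) z|.
Proof.
move=> H; rewrite normrM.
have [z1|z1] := boolP (s <= z.1 <= t); last first.
  by rewrite /tens (test_support Tphi)// mul0r normr0 !mulr0.
have [z2|z2] := boolP (s <= z.2 <= t); last first.
  by rewrite /tens (test_support Tpsi)// mulr0 normr0 !mulr0.
by rewrite ler_wpM2r// H.
Qed.

End TensorSupport.

(** * Weak mixed derivatives *)

Section WeakDerivative.
Variable R : realType.
Notation leb := (@lebesgue_measure R).
Notation J := (leb \x leb)%E.
Variables (a b s t B : R) (k l : nat) (G W : nat -> R -> R -> R).
Variables (phi psi : nat -> R -> R).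
Hypotheses (as_ : a < s) (tb : t < b).
Hypothesis cG : forall x, a < x < b -> chain a b l (fun q => G q x).
Hypothesis cW : forall y, a < y < b -> chain a b k (fun p => W p ^~ y).
Hypothesis GW : G l = W 0%N.
Hypothesis WB : forall x y, a < x < b -> a < y < b -> `|W k x y| <= B.
Hypothesis iG : J.-integrable setT (EFin \o uncurry2 (G 0%N)).
Hypothesis Tphi : test_chain k s t phi.
Hypothesis Tpsi : test_chain l s t psi.

(** Up to [k + l] steps of length at most [e] to the right, starting in [[s, t]], stay strictly
    below [b]. *)
Let e := (b - t) / (k + l).+1%:R.
Let d (n : nat) := e / n.+1%:R.

Let e0 : 0 < e. Proof. by rewrite divr_gt0// subr_gt0. Qed.
Let d0 n : 0 < d n. Proof. by rewrite divr_gt0. Qed.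
Let de n : d n <= e.
Proof. by rewrite ler_pdivrMr// ler_peMr ?ler1n// ltW. Qed.

Let dk n q x : (q <= k + l)%N -> s <= x <= t -> a < x < b /\ a < x + q%:R * d n < b.
Proof.
move=> qkl /andP[sx xt].
have h : q%:R * d n < b - t.
  apply: le_lt_trans (_ : (k + l)%:R * e < _).
    by rewrite ler_pM// ?ler_nat// ltW.
  rewrite /e mulrCA gtr_pMr ?subr_gt0// ltr_pdivrMr// mul1r ltr_nat//.
have h0 : 0 <= q%:R * d n by rewrite mulr_ge0// ltW.
move: (q%:R * d n) h h0 => w h h0.
have ax : a < x := lt_le_trans as_ sx.
have xb : x < b := le_lt_trans xt tb.
by split; apply/andP; split=> //; lra.
Qed.

Let bphi q : (q <= k)%N -> bounded_measurable (phi q).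
Proof. exact: test_bounded Tphi. Qed.

Let bpsi q : (q <= l)%N -> bounded_measurable (psi q).
Proof. exact: test_bounded Tpsi. Qed.

Let tens_cvg := tens_support_cvg Tphi Tpsi.

Let tens_le := tens_support_le Tphi Tpsi.

Let B_tens := fun z => B * `|tens (phi 0%N) (psi 0%N) z|.

Let integrable_B_tens : J.-integrable setT (EFin \o B_tens).
Proof.
apply/integrable_plane_Zl/integrable_plane_norm.
exact: integrable_tens_test Tphi Tpsi _ _.
Qed.

Let A n m := iter k (dq1 (d n)) (iter l (dq2 (d m)) (G 0%N)).

Let A_int n m :
  J.-integrable setT (EFin \o (fun z => uncurry2 (A n m) z * tens (phi 0%N) (psi 0%N) z)).
Proof.
have [iA _] := adjoint_mixed k l (d n) (d m) iG (bphi (leq0n _)) (bpsi (leq0n _)).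
by apply: integrable_mul_tens => //; [exact: bphi|exact: bpsi].
Qed.

Let A_le n m z : `|uncurry2 (A n m) z * tens (phi 0%N) (psi 0%N) z| <= B_tens z.
Proof.
apply: tens_le => z1 z2.
have [h1 h2] := dk n (leq_addr l k) z1.
have [h3 h4] := dk m (leq_addl k l) z2.
rewrite /uncurry2 /A.
have [u [v [uab vab ->]]] := mixed_mean_value cG cW GW (lt0r_neq0 (d0 n)) (lt0r_neq0 (d0 m)) h1 h2 h3 h4.
exact: WB.
Qed.

Let A1 n := iter k (dq1 (d n)) (W 0%N).

Let step2 n :
  J.-integrable setT (EFin \o (fun z => uncurry2 (A1 n) z * tens (phi 0%N) (psi 0%N) z)) /\
  \int[J]_z (uncurry2 (A n m) z * tens (phi 0%N) (psi 0%N) z) @[m --> \oo] -->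
  \int[J]_z (uncurry2 (A1 n) z * tens (phi 0%N) (psi 0%N) z).
Proof.
apply: (@dominated_cvg_plane R _ _ B_tens) => //.
- by move=> m; exact: integrable_plane_measurable (A_int n m).
- move=> z; apply: (@tens_cvg (fun m => uncurry2 (A n m) z)) => z1 z2.
  have [h1 h2] := dk n (leq_addr l k) z1.
  have [h3 _] := dk n (leq_addl k l) z2.
  exact: (dnbhs_step e0 (mixed_cvg2 cG GW h1 h2 h3)).
Qed.

Let A1_le n z : `|uncurry2 (A1 n) z * tens (phi 0%N) (psi 0%N) z| <= B_tens z.
Proof.
apply: tens_le => z1 z2.
have [h1 h2] := dk n (leq_addr l k) z1.
have [h3 _] := dk n (leq_addl k l) z2.
have := iter_dq_mean_value (lt0r_neq0 (d0 n)) (cW h3) h1 h2.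
rewrite /uncurry2 /A1 iter_dq1E => -[c [cab _ ->]].
exact: WB.
Qed.

Let step1 :
  J.-integrable setT (EFin \o (fun z => uncurry2 (W k) z * tens (phi 0%N) (psi 0%N) z)) /\
  \int[J]_z (uncurry2 (A1 n) z * tens (phi 0%N) (psi 0%N) z) @[n --> \oo] -->
  \int[J]_z (uncurry2 (W k) z * tens (phi 0%N) (psi 0%N) z).
Proof.
apply: (@dominated_cvg_plane R _ _ B_tens) => //.
- by move=> n; apply: integrable_plane_measurable; have [] := step2 n.
- move=> z; apply: (@tens_cvg (fun n => uncurry2 (A1 n) z)) => z1 z2.
  have [h1 _] := dk 0 (leq_addr l k) z1.
  have [h3 _] := dk 0 (leq_addl k l) z2.
  exact: (dnbhs_step e0 (mixed_cvg1 cW h1 h3)).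
Qed.

(** [W k] is merely bounded on the open square; its product with the test function is measurable as
    a limit of quotients. Both sides of [adjoint_mixed] pass to the limit in [m], then in [n]: the
    left side is dominated through mean values of [W k], the right side through bounds on the
    quotients of [phi] and [psi]. *)
Lemma weak_mixed_derivative :
  J.-integrable setT (EFin \o (fun z => uncurry2 (W k) z * tens (phi 0%N) (psi 0%N) z)) /\
  \int[J]_z (uncurry2 (W k) z * tens (phi 0%N) (psi 0%N) z) =
  (-1) ^+ (k + l) * \int[J]_z (uncurry2 (G 0%N) z * tens (phi k) (psi l) z).
Proof.
have [iW cvgW] := step1; split=> //.
have nd n : - d n != 0 by rewrite oppr_eq0 lt0r_neq0.
have E1 n : \int[J]_z (uncurry2 (A1 n) z * tens (phi 0%N) (psi 0%N) z) =
  (-1) ^+ (k + l) * \int[J]_z (uncurry2 (G 0%N) z * tens (iter k (dq (- d n)) (phi 0%N)) (psi l) z).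
  apply: (@cvg_unique _ (@Rhausdorff R) _ _ _ _ (proj2 (step2 n))).
  have E m : \int[J]_z (uncurry2 (A n m) z * tens (phi 0%N) (psi 0%N) z) = _ :=
    (adjoint_mixed k l (d n) (d m) iG (bphi (leq0n _)) (bpsi (leq0n _))).2.
  rewrite /=; under eq_fun do rewrite E.
  apply: cvgMr; apply: Rintegral_mul_tens_cvg => [//|_|m|||x|x].
  - exact/bounded_measurable_iter_dq/bphi.
  - exact/bounded_measurable_iter_dq/bpsi.
  - have [_ [C HC]] := bounded_measurable_iter_dq k (- d n) (bphi (leq0n k)).
    by exists C.
  - have [_ [C HC]] := bpsi (leqnn l); exists C => m x.
    exact: (test_iter_dq_bound _ Tpsi (leqnn l) (nd m) HC).
  - exact: cvg_cst.
  - exact: (dnbhs_stepN e0 (test_iter_dq_cvg (x := x) Tpsi (leqnn l))).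
apply: (@cvg_unique _ (@Rhausdorff R) _ _ _ _ cvgW).
rewrite /=; under eq_fun do rewrite E1.
apply: cvgMr; apply: Rintegral_mul_tens_cvg => [//|n|_|||x|x].
- exact/bounded_measurable_iter_dq/bphi.
- exact: bpsi.
- have [_ [C HC]] := bphi (leqnn k); exists C => m x.
  exact: (test_iter_dq_bound _ Tphi (leqnn k) (nd m) HC).
- have [_ [C HC]] := bpsi (leqnn l); by exists C.
- exact: (dnbhs_stepN e0 (test_iter_dq_cvg (x := x) Tphi (leqnn k))).
- exact: cvg_cst.
Qed.

End WeakDerivative.

(** * The bound by the variation of the Stieltjes measure *)

Section PlaneMeasure.
Variable R : realType.
Notation leb := (@lebesgue_measure R).

(* MathComp-Analysis infers no sigma-finite structure for [leb \x leb] itself: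
   its canonical instance is shadowed by the one for probabilities. *)
Definition plane_measure : set (plane R) -> \bar R := (leb \x leb)%E.

HB.instance Definition _ := Measure.on plane_measure.

Lemma plane_measure_sigma_finite : sigma_finite setT plane_measure.
Proof.
have /sigma_finiteP[F [TF ndF Foo]] := sigma_finiteT leb.
exists (fun n => F n `*` F n).
  rewrite -setXTT TF predeqE => -[x y]; split.
    move=> [/= [n _ Fnx] [k _ Gky]]; exists (maxn n k) => //; split.
    - by move: x Fnx; exact/subsetPset/ndF/leq_maxl.
    - by move: y Gky; exact/subsetPset/ndF/leq_maxr.
  by move=> [n _ []/= ? ?]; split; exists n.
move=> k; have [? ?] := Foo k.
split; first exact: measurableX.
by rewrite /plane_measure product_measure1E// lte_mul_pinfty// ge0_fin_numE.
Qed.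

HB.instance Definition _ :=
  Measure_isSigmaFinite.Build _ _ _ plane_measure plane_measure_sigma_finite.

End PlaneMeasure.

Section Tonelli.
Variable R : realType.
Notation leb := (@lebesgue_measure R).
Notation J := (leb \x leb)%E.
Variable nu : {finite_measure set (plane R) -> \bar R}.

Definition cell (e : R) (z : plane R) : set (plane R) :=
  `]z.1, z.1 + e] `*` `]z.2, z.2 + e].

Lemma measurable_cell_graph e : measurable [set p : plane R * plane R | cell e p.1 p.2].
Proof.
have m1 (i : plane R -> R) : measurable_fun setT i ->
    measurable_fun setT (fun p : plane R * plane R => i p.1).
  by move=> mi; exact: measurableT_comp mi measurable_fst.
have m2 (i : plane R -> R) : measurable_fun setT i ->
    measurable_fun setT (fun p : plane R * plane R => i p.2).
  by move=> mi; exact: measurableT_comp mi measurable_snd.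
have mf : measurable_fun setT (fst : plane R -> R) := measurable_fst.
have ms : measurable_fun setT (snd : plane R -> R) := measurable_snd.
have part (i : plane R -> R) : measurable_fun setT i ->
    measurable [set p : plane R * plane R | i p.2 \in `]i p.1, i p.1 + e]].
  move=> mi.
  have h : measurable_fun setT (fun p : plane R * plane R =>
      (i p.1 < i p.2) && (i p.2 <= i p.1 + e)).
    apply: measurable_and.
      by apply: measurable_fun_ltr; [exact: m1|exact: m2].
    apply: measurable_fun_ler; first exact: m2.
    by apply: measurable_funD; [exact: m1|exact: measurable_cst].
  have := h measurableT [set true] (I : measurable [set true]).
  by rewrite setTI.
have := measurableI _ _ (part _ mf) (part _ ms).
by [].
Qed.

(** By Tonelli: [w] lies in the cell at [z] exactly when [z] lies in the half-open square of side
    [e] whose upper right corner is [w]. *)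
Lemma integral_cell e : 0 <= e ->
  (\int[J]_z nu (cell e z))%E = ((e * e)%:E * nu setT)%E.
Proof.
move=> e0; set E := [set p : plane R * plane R | cell e p.1 p.2].
have mE : measurable E := measurable_cell_graph e.
have := @indic_fubini_tonelli _ _ (plane R) (plane R) R (@plane_measure R) nu E mE.
rewrite indic_fubini_tonelli_FE// indic_fubini_tonelli_GE//.
have -> : nu \o xsection E = (fun z => nu (cell e z)).
  by apply/funext => z /=; congr (nu _); apply/seteqP; split=> w; rewrite /xsection/= inE.
move=> H; rewrite [LHS]H.
have -> : @plane_measure R \o ysection E = (fun=> (e * e)%:E).
  apply/funext => w /=.
  have -> : ysection E w = `[w.1 - e, w.1[ `*` `[w.2 - e, w.2[.
    apply/seteqP; split=> z; rewrite /ysection/= inE /E/= /cell/= !in_itv/=.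
      by move=> [/andP[? ?] /andP[? ?]]; split; apply/andP; split => //; rewrite lerBlDr.
    by move=> [/andP[? ?] /andP[? ?]]; split; apply/andP; split => //; rewrite -lerBlDr.
  rewrite /plane_measure product_measure1E//.
  have L (r : R) : leb `[r - e, r[%classic = e%:E.
    rewrite lebesgue_measure_itv/= lte_fin -subr_gt0 opprB addrC subrK.
    case: ltP => [_|e0']; first by rewrite -EFinD addrC subrK.
    by congr EFin; apply/eqP; rewrite eq_le e0.
  by rewrite EFinM; congr (_ * _)%E; exact: L.
by rewrite integral_cst.
Qed.

End Tonelli.

Section CoreInequality.
Variable R : realType.
Notation leb := (@lebesgue_measure R).
Notation J := (leb \x leb)%E.
Variables (a b s t M Cphi Cpsi : R) (k l : nat) (F U : nat -> R -> R -> R).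
Variables (phi psi : nat -> R -> R).
Variables (nu : {finite_measure set (plane R) -> \bar R}).
Variable (m : R -> R -> R -> R -> R).
Hypotheses (as_ : a < s) (tb : t < b).
Hypothesis cF : forall x, a < x < b -> chain a b l (fun q => F q x).
Hypothesis cU : forall y, a < y < b -> chain a b k (fun p => U p ^~ y).
Hypothesis FU : F l = U 0%N.
Hypothesis iF : J.-integrable setT (EFin \o uncurry2 (F 0%N)).
Hypothesis incM : forall x x' y y', a < x -> x < x' -> x' < b ->
  a < y -> y < y' -> y' < b -> `|increment (U k) x x' y y'| <= M.
Hypothesis inc_cvg : forall x x' y y', a < x -> x < x' -> x' < b ->
  a < y -> y < y' -> y' < b ->
  increment (U k) (x + e) (x' + e) (y + e) (y' + e) @[e --> 0^'+] --> m x x' y y'.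
Hypothesis m_le : forall x x' y y', a < x -> x < x' -> x' < b ->
  a < y -> y < y' -> y' < b ->
  (`|m x x' y y'|%:E <= nu (`]x, x'] `*` `]y, y']))%E.
Hypothesis Tphi : test_chain k.+1 s t phi.
Hypothesis Tpsi : test_chain l.+1 s t psi.
Hypothesis phiC : forall x, `|phi 0%N x| <= Cphi.
Hypothesis psiC : forall x, `|psi 0%N x| <= Cpsi.

Section Step.
Variable e : R.
Hypotheses (e0 : 0 < e) (eb : t + e + e < b).

(** Differencing first makes the top function [W k] bounded, by [M / (e * e)], as
    [weak_mixed_derivative] demands. *)
Let G q := dq1 e (dq2 e (F q)).
Let W p := dq1 e (dq2 e (U p)).

Lemma chain_narrow n (H : nat -> R -> R) :
  chain (Num.max a (a - e)) (Num.min b (b - e)) n H -> chain a (b - e) n H.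
Proof.
move=> cH q qn x xab; apply: cH => //.
by rewrite gt_max lt_min; apply/andP; split; apply/andP; split; have := e0; lra.
Qed.

Let cG x : a < x < b - e -> chain a (b - e) l (fun q => G q x).
Proof.
move=> xab.
have c1 z : a < z < b -> chain a (b - e) l (fun q => dq2 e (F q) z).
  by move=> zab; apply/chain_narrow/chain_dq; [rewrite gt_eqF|exact: cF].
by apply: chain_dqB; apply: c1; have := e0; lra.
Qed.

Let cW y : a < y < b - e -> chain a (b - e) k (fun p => W p ^~ y).
Proof.
move=> yab.
have c1 z : a < z < b -> chain a (b - e) k (fun p => dq1 e (U p) ^~ z).
  by move=> zab; apply/chain_narrow/chain_dq; [rewrite gt_eqF|exact: cU].
rewrite /W (_ : (fun p => _) = fun p x => (dq1 e (U p) x (y + e) - dq1 e (U p) x y) / e).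
  by apply: (@chain_dqB R _ _ _ (fun p => dq1 e (U p) ^~ (y + e)) (fun p => dq1 e (U p) ^~ y));
    apply: c1; have := e0; lra.
by apply/funext => p; apply/funext => x; rewrite dq1_dq2C.
Qed.

Let GW : G l = W 0%N.
Proof. by rewrite /G /W FU. Qed.

Let WE x y : W k x y = increment (U k) x (x + e) y (y + e) / (e * e).
Proof.
by rewrite /W /dq1 /dq2 /dq /increment; have := lt0r_neq0 e0 => ?; field.
Qed.

Let WM x y : a < x < b - e -> a < y < b - e -> `|W k x y| <= M / (e * e).
Proof.
move=> xab yab; rewrite WE normrM normfV (ger0_norm (_ : 0 <= e * e)).
  by rewrite ler_pM2r ?invr_gt0 ?mulr_gt0//; apply: incM; have := e0; lra.
by rewrite mulr_ge0// ltW.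
Qed.

Let iGc : J.-integrable setT (EFin \o uncurry2 (G 0%N)).
Proof.
(* Zero weights: only the integrability half of the adjoint lemmas is wanted. *)
have b1 : bounded_measurable (cst 0 : R -> R).
  by split; [exact: measurable_cst|exists 0 => x; rewrite normr0].
have [h _] := adjoint_dq2 e iF b1 b1.
by have [] := adjoint_dq1 e h b1 b1.
Qed.

Let u_ (h : R) := dq (- e) (fun x => phi k (x - h)).
Let v_ (h : R) := dq (- e) (fun x => psi l (x - h)).

Let bphi h q : (q <= k.+1)%N -> bounded_measurable (fun x => phi q (x - h)).
Proof. by move=> qk; exact/bounded_measurable_shift/(test_bounded Tphi). Qed.

Let bpsi h q : (q <= l.+1)%N -> bounded_measurable (fun x => psi q (x - h)).
Proof. by move=> qk; exact/bounded_measurable_shift/(test_bounded Tpsi). Qed.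

(** The shift goes onto the test functions, [weak_mixed_derivative] moves the derivatives of the
    differenced functions, and [adjoint_mixed 1 1], of sign [+1], moves the remaining quotient of
    step [e] in each variable. *)
Let shifted h : 0 <= h -> t + h < b - e ->
  J.-integrable setT (EFin \o (fun z => uncurry2 (W k) (shift2 h h z) * tens (phi 0%N) (psi 0%N) z)) /\
  \int[J]_z (uncurry2 (W k) (shift2 h h z) * tens (phi 0%N) (psi 0%N) z) =
  (-1) ^+ (k + l) * \int[J]_z (uncurry2 (F 0%N) z * tens (u_ h) (v_ h) z).
Proof.
move=> h0 hb.
have T1 := test_le (leqnSn k) (test_shift h Tphi).
have T2 := test_le (leqnSn l) (test_shift h Tpsi).
have as' : a < s + h by rewrite ltr_wpDr.
have [iW E] := weak_mixed_derivative as' hb cG cW GW WM iGc T1 T2.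
have tE : (fun z => uncurry2 (W k) (shift2 h h z) * tens (phi 0%N) (psi 0%N) z) =
  (fun z => uncurry2 (W k) z * tens (fun x => phi 0%N (x - h)) (fun x => psi 0%N (x - h)) z) \o shift2 h h.
  by apply/funext => z; rewrite /= /tens /= !addrK.
split; first by rewrite tE; exact: integrable_shift2.
have -> : \int[J]_z (uncurry2 (W k) (shift2 h h z) * tens (phi 0%N) (psi 0%N) z) =
  \int[J]_z (uncurry2 (W k) z * tens (fun x => phi 0%N (x - h)) (fun x => psi 0%N (x - h)) z).
  by rewrite -(Rintegral_shift2 h h iW); apply: eq_Rintegral => z _; rewrite /= /tens /= !addrK.
rewrite E; congr (_ * _).
have [_ ->] := adjoint_mixed 1 1 e e iF (bphi h (leqnSn k)) (bpsi h (leqnSn l)).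
by rewrite addn1 expr2 mulrNN !mul1r.
Qed.

Let mt (z : plane R) := m z.1 (z.1 + e) z.2 (z.2 + e) / (e * e).

(** Half of the room left between [t + e] and [b]. *)
Let h0 := (b - e - t) / 2.

Let h0_gt0 : 0 < h0.
Proof. by rewrite divr_gt0// subr_gt0; have := eb; have := e0; lra. Qed.

Let hn n : 0 < h0 / n.+1%:R /\ t + h0 / n.+1%:R < b - e.
Proof.
split; first by rewrite divr_gt0.
have : h0 / n.+1%:R <= h0 by rewrite ler_pdivrMr// ler_peMr ?ler1n// ltW.
by rewrite /h0; move: (_ / n.+1%:R) => w; have := h0_gt0; rewrite /h0; lra.
Qed.

(** Letting the shift decrease to [0] realizes the right limit in [inc_cvg]: the increment over the
    shifted cell becomes [m] of the cell. *)
Let cell_cvg :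
  J.-integrable setT (EFin \o (fun z => mt z * tens (phi 0%N) (psi 0%N) z)) /\
  \int[J]_z (uncurry2 (W k) (shift2 (h0 / n.+1%:R) (h0 / n.+1%:R) z) * tens (phi 0%N) (psi 0%N) z)
    @[n --> \oo] --> \int[J]_z (mt z * tens (phi 0%N) (psi 0%N) z).
Proof.
have hn' n := proj2 (hn n).
apply: (@dominated_cvg_plane _ _ _ (fun z => (M / (e * e)) * `|tens (phi 0%N) (psi 0%N) z|)).
- move=> n; have [h1 h2] := hn n; apply: integrable_plane_measurable.
  by have [] := shifted (ltW h1) h2.
- move=> z; apply: (@tens_support_cvg _ s t _ _ _ _ Tphi Tpsi
    (fun n => uncurry2 (W k) (shift2 (h0 / n.+1%:R) (h0 / n.+1%:R) z))) => /andP[z1 z1'] /andP[z2 z2'].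
  rewrite /mt /uncurry2 /=; under eq_fun do rewrite WE.
  apply: cvgMl; rewrite -?(addrAC _ e).
  have := inc_cvg (x := z.1) (x' := z.1 + e) (y := z.2) (y' := z.2 + e).
  have e0' := e0; have eb' := eb; have as' := as_.
  move=> /(_ ltac:(lra) ltac:(lra) ltac:(lra) ltac:(lra) ltac:(lra) ltac:(lra)).
  move=> /cvg_at_rightP/(_ (fun n => h0 / n.+1%:R)) H.
  under eq_fun do rewrite (addrAC z.1 _ e) (addrAC z.2 _ e).
  by apply: H; split; [move=> n; case: (hn n)|exact: cvg_step].
- apply/integrable_plane_Zl/integrable_plane_norm.
  exact: (integrable_tens_test Tphi Tpsi (leq0n _) (leq0n _)).
- move=> n z; apply: (tens_support_le Tphi Tpsi) => /andP[z1 z1'] /andP[z2 z2'].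
  have [h1 h2] := hn n; rewrite /uncurry2; have := as_.
  by move: (_ / n.+1%:R) h1 h2 => w h1 h2 ?; apply: WM => /=; lra.
Qed.

Let dual_shift_cvg :
  \int[J]_z (uncurry2 (F 0%N) z * tens (u_ (h0 / n.+1%:R)) (v_ (h0 / n.+1%:R)) z)
    @[n --> \oo] -->
  \int[J]_z (uncurry2 (F 0%N) z * tens (dq (- e) (phi k)) (dq (- e) (psi l)) z).
Proof.
have gen n c (chi : nat -> R -> R) x : test_chain n s t chi -> (c <= n)%N ->
    dq (- e) (fun y => chi c (y - h0 / i.+1%:R)) x @[i --> \oo] --> dq (- e) (chi c) x.
  move=> Tchi cn; apply: cvgMl.
  have cc y : chi c (y - h0 / i.+1%:R) @[i --> \oo] --> chi c y.
    have hy : (y - h0 / i.+1%:R) @[i --> \oo] --> y.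
      by rewrite -[X in _ --> X]subr0; apply: cvgB; [exact: cvg_cst|exact: cvg_step].
    have cy : {for y, continuous (chi c)} by apply: (test_continuous Tchi cn).
    exact: (cvg_comp _ _ hy cy).
  by apply: cvgB; exact: cc.
have bnd n c (chi : nat -> R -> R) : test_chain n s t chi -> (c <= n)%N ->
    exists C, forall (i : nat) x, `|dq (- e) (fun y => chi c (y - h0 / i.+1%:R)) x| <= C.
  move=> Tchi cn; have [_ [C HC]] := test_bounded Tchi cn.
  exists ((C + C) * `|- e|^-1) => i x; rewrite /dq normrM normfV ler_wpM2r ?invr_ge0//.
  by rewrite (le_trans (ler_normB _ _))// lerD.
apply: Rintegral_mul_tens_cvg => //.
- by move=> n; exact/bounded_measurable_dq/bphi.
- by move=> n; exact/bounded_measurable_dq/bpsi.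
- exact: (bnd k.+1).
- exact: (bnd l.+1).
- by move=> x; exact: (gen k.+1).
- by move=> x; exact: (gen l.+1).
Qed.

Let mt_le z : (`|mt z * tens (phi 0%N) (psi 0%N) z|%:E <=
  (Cphi * Cpsi / (e * e))%:E * nu (cell e z))%E.
Proof.
have Cphi0 : 0 <= Cphi := le_trans (normr_ge0 _) (phiC 0).
have Cpsi0 : 0 <= Cpsi := le_trans (normr_ge0 _) (psiC 0).
have ee0 : 0 < e * e by rewrite mulr_gt0.
have rhs0 : (0 <= (Cphi * Cpsi / (e * e))%:E * nu (cell e z))%E.
  by rewrite mule_ge0// lee_fin divr_ge0 ?mulr_ge0// ltW.
have [z1|z1] := boolP (s <= z.1 <= t); last first.
  by rewrite /tens (test_support Tphi)// mul0r mulr0 normr0.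
have [z2|z2] := boolP (s <= z.2 <= t); last first.
  by rewrite /tens (test_support Tpsi)// !mulr0 normr0.
have -> : `|mt z * tens (phi 0%N) (psi 0%N) z| =
    (`|phi 0%N z.1| * `|psi 0%N z.2| / (e * e)) * `|m z.1 (z.1 + e) z.2 (z.2 + e)|.
  by rewrite /mt /tens !normrM normfV (gtr0_norm ee0); ring.
rewrite EFinM; apply: lee_pmul.
- by rewrite lee_fin !mulr_ge0// invr_ge0 ltW.
- by rewrite lee_fin.
- by rewrite lee_fin ler_pM2r ?invr_gt0// ler_pM.
- have e0' := e0; have eb' := eb; have as' := as_.
  by apply: m_le; move: z1 z2 => /andP[? ?] /andP[? ?]; lra.
Qed.

(** The right side is free of [e]: [mt_le] costs a factor [1 / e^2], and [integral_cell] gives back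
    [e^2]. *)
Lemma core_step :
  `|\int[J]_z (uncurry2 (F 0%N) z * tens (dq (- e) (phi k)) (dq (- e) (psi l)) z)|
  <= Cphi * Cpsi * fine (nu setT).
Proof.
have [imt cmt] := cell_cvg.
have -> : \int[J]_z (uncurry2 (F 0%N) z * tens (dq (- e) (phi k)) (dq (- e) (psi l)) z) =
    (-1) ^+ (k + l) * \int[J]_z (mt z * tens (phi 0%N) (psi 0%N) z).
  apply: (@cvg_unique _ (@Rhausdorff R) _ _ _ _ dual_shift_cvg) => /=.
  have E n : \int[J]_z (uncurry2 (F 0%N) z * tens (u_ (h0 / n.+1%:R)) (v_ (h0 / n.+1%:R)) z) =
     (-1) ^+ (k + l) * \int[J]_z (uncurry2 (W k) (shift2 (h0 / n.+1%:R) (h0 / n.+1%:R) z) * tens (phi 0%N) (psi 0%N) z).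
    have [h1 h2] := hn n; have [_ ->] := shifted (ltW h1) h2.
    by rewrite mulrA -exprD addnn -mul2n exprM sqrrN !expr1n mul1r.
  under eq_fun do rewrite E.
  by apply: cvgMr.
rewrite normrM normrX normrN1 expr1n mul1r -lee_fin.
rewrite (EFin_normr_Rintegral measurableT imt).
apply: le_trans (le_abse_integral _ measurableT (measurable_int _ imt)) _.
have ee0 : 0 < e * e by rewrite mulr_gt0.
have Cphi0 : 0 <= Cphi := le_trans (normr_ge0 _) (phiC 0).
have Cpsi0 : 0 <= Cpsi := le_trans (normr_ge0 _) (psiC 0).
have mc : measurable_fun setT (fun z => nu (cell e z)).
  have := measurable_fun_xsection nu (measurable_cell_graph e).
  congr measurable_fun; apply/funext => z /=; congr (nu _); apply/seteqP.
  by split=> w; rewrite /xsection/= inE.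
apply: (@le_trans _ _ (\int[J]_z ((Cphi * Cpsi / (e * e))%:E * nu (cell e z)))%E).
  apply: ge0_le_integral => //.
  - by apply: measurableT_comp => //; exact: measurable_int imt.
  - by apply: measurable_funeM.
  - by move=> z _; exact: mt_le.
rewrite ge0_integralZl//; last by rewrite lee_fin divr_ge0 ?mulr_ge0// ltW.
rewrite integral_cell; last exact: ltW.
rewrite muleA -EFinM divfK ?gt_eqF//.
rewrite -{1}(fineK (fin_num_measure nu setT measurableT)) -EFinM.
exact: lexx.
Qed.

End Step.

Lemma core_inequality :
  `|\int[J]_z (uncurry2 (F 0%N) z * tens (phi k.+1) (psi l.+1) z)|
  <= Cphi * Cpsi * fine (nu setT).
Proof.
(* With steps at most a quarter of the gap, [t + 2 e < b] holds for every step [e]. *)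
pose e0 := (b - t) / 4.
have e00 : 0 < e0 by rewrite divr_gt0// subr_gt0.
have en n : 0 < e0 / n.+1%:R /\ t + e0 / n.+1%:R + e0 / n.+1%:R < b.
  split; first by rewrite divr_gt0.
  have : e0 / n.+1%:R <= e0 by rewrite ler_pdivrMr// ler_peMr ?ler1n// ltW.
  by move: (_ / n.+1%:R) e00 => w; rewrite /e0; lra.
have gen n (chi : nat -> R -> R) x : test_chain n.+1 s t chi ->
    dq (- (e0 / i.+1%:R)) (chi n) x @[i --> \oo] --> chi n.+1 x.
  move=> Tchi.
  have := (dq_cvg_derive _ _ _).1 (test_derive Tchi (ltnSn n) x).
  exact: dnbhs_stepN.
have bnd n (chi : nat -> R -> R) : test_chain n.+1 s t chi ->
    exists C, forall (i : nat) x, `|dq (- (e0 / i.+1%:R)) (chi n) x| <= C.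
  move=> Tchi; have [_ [C HC]] := test_bounded Tchi (leqnn _).
  exists C => i x; have [ei _] := en i.
  (* A single quotient of [chi n] is bounded by its derivative: the tail of the chain, of length
     one. *)
  have Tt : test_chain 1 s t (fun q => chi (n + q)%N).
    by apply: test_tail; rewrite addn1.
  have := @test_iter_dq_bound _ 1 s t _ 1 (- (e0 / i.+1%:R)) C x Tt (leqnn _).
  by rewrite /= addn0 addn1 oppr_eq0 gt_eqF// => /(_ isT HC).
have lim : \int[J]_z (uncurry2 (F 0%N) z *
      tens (dq (- (e0 / n.+1%:R)) (phi k)) (dq (- (e0 / n.+1%:R)) (psi l)) z)
    @[n --> \oo] --> \int[J]_z (uncurry2 (F 0%N) z * tens (phi k.+1) (psi l.+1) z).
  apply: Rintegral_mul_tens_cvg => //.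
  - by move=> n; exact/bounded_measurable_dq/(test_bounded Tphi).
  - by move=> n; exact/bounded_measurable_dq/(test_bounded Tpsi).
  - exact: bnd.
  - exact: bnd.
  - by move=> x; exact: gen.
  - by move=> x; exact: gen.
apply: (@ler_cvg_to _ _ _ _ _ _ _ _ (cvg_norm lim) (cvg_cst _)).
by apply: nearW => n; have [h1 h2] := en n; exact: core_step.
Qed.

End CoreInequality.

(** * The substitution x = cos theta *)

Section CosineSubstitution.
Variable R : realType.
Notation leb := (@lebesgue_measure R).
Notation J := (leb \x leb)%E.
Local Notation U11 := (`]-1, 1[%classic : set (measurableTypeR R)).

(** The Jacobian of the cosine, up to sign, cut off to the interval that the cosine maps bijectively
    onto []-1, 1[]. *)
Definition sin0pi (th : R) : R := if 0 < th < pi then sin th else 0.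

Lemma sin0pi_ge0 th : 0 <= sin0pi th.
Proof. by rewrite /sin0pi; case: ifPn => // h; rewrite ltW// sin_gt0_pi. Qed.

Lemma measurable_sin0pi : measurable_fun setT sin0pi.
Proof.
apply: measurable_fun_ifT => //.
  apply: measurable_and; apply: measurable_fun_ltr => //.
  exact: continuous_measurable_fun (@continuous_sin R).
Qed.

Lemma measurable_cos : measurable_fun setT (@cos R).
Proof. exact: continuous_measurable_fun (@continuous_cos R). Qed.

Definition under_sine (p : plane R) : bool := (0 <= p.2) && (p.2 < sin0pi p.1).

Lemma under_sineP p : under_sine p -> 0 < p.1 < pi.
Proof.
by rewrite /under_sine /sin0pi; case: ifPn => // _ /andP[h1 /(le_lt_trans h1)]; rewrite ltxx.
Qed.

Lemma measurable_under_sine : measurable_fun setT under_sine.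
Proof.
apply: measurable_and.
  by apply: measurable_fun_ler => //; exact: measurable_snd.
apply: measurable_fun_ltr; first exact: measurable_snd.
exact: measurableT_comp measurable_sin0pi measurable_fst.
Qed.

(* The region under the graph of the sine is sent to ]-1, 1[ by the cosine of
   the abscissa, and everything else to the dummy point 2: on ]-1, 1[ the
   pushforward of [J] is the Lebesgue measure, which gives the substitution
   [x = cos th] for functions that are merely measurable. *)
Definition cos_of_area (p : plane R) : measurableTypeR R :=
  if under_sine p then cos p.1 else 2.

Lemma measurable_cos_of_area : measurable_fun setT cos_of_area.
Proof.
apply: measurable_fun_ifT => //; first exact: measurable_under_sine.
exact: measurableT_comp measurable_cos measurable_fst.
Qed.

Lemma cos_0pi (th : R) : 0 < th < pi -> -1 < cos th < 1.
Proof.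
move=> /andP[h1 h2]; have pi0 := pi_gt0 R.
rewrite -cospi -cos0 !ltr_cos ?in_itv/= ?lexx ?(ltW h1) ?(ltW h2) ?(ltW pi0)//.
by rewrite h1 h2.
Qed.

Lemma cos_of_area_preimage : cos_of_area @^-1` U11 = [set p | under_sine p].
Proof.
apply/seteqP; split=> p; rewrite /cos_of_area /= in_itv/=.
  by case: ifPn => // _ /andP[_]; rewrite ltNge ler1n.
by move=> up; rewrite up; exact/cos_0pi/under_sineP.
Qed.

Lemma tonelli_under_sine (F : R -> \bar R) : measurable_fun setT F ->
  (forall x, 0 <= F x)%E ->
  (\int[J]_(p in [set p | under_sine p]) F (cos p.1) =
   \int[leb]_th (F (cos th) * (sin0pi th)%:E))%E.
Proof.
move=> mF F0.
have mU : measurable [set p | under_sine p].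
  by have := measurable_under_sine measurableT (I : measurable [set true]); rewrite setTI.
rewrite integral_mkcond fubini_tonelli1; last 2 first.
- apply: (measurable_restrictT _ _).1 => //; apply: measurable_funTS.
  exact: measurableT_comp mF (measurableT_comp measurable_cos measurable_fst).
- by move=> p; rewrite patchE; case: ifPn.
apply: eq_integral => th _; rewrite /fubini_F.
transitivity (\int[leb]_(t in `[0%R, sin0pi th[) (cst (F (cos th))) t)%E.
  rewrite [RHS]integral_mkcond; apply: eq_integral => t _.
  by rewrite !patchE; congr (if _ then _ else _).
transitivity (F (cos th) * leb `[0%R, sin0pi th[%classic)%E.
  by rewrite integral_cst//; exact: measurable_itv.
congr (_ * _)%E; rewrite lebesgue_measure_itv/= lte_fin.
case: ifPn => [_|]; first by rewrite -EFinB subr0.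
by rewrite -leNgt => h; congr EFin; apply/eqP; rewrite eq_le sin0pi_ge0.
Qed.

Definition cos_measure : {measure set (measurableTypeR R) -> \bar R} :=
  measure_function_pushforward__canonical__measure_function_Measure
    J measurable_cos_of_area.

Lemma integral_cos_measure (F : R -> \bar R) : measurable_fun setT F ->
  (forall x, 0 <= F x)%E ->
  (\int[cos_measure]_(x in U11) F x =
   \int[leb]_th (F (cos th) * (sin0pi th)%:E))%E.
Proof.
move=> mF F0; rewrite -tonelli_under_sine// ge0_integral_pushforward//.
- rewrite cos_of_area_preimage; apply: eq_integral => p; rewrite inE/= => up.
  by rewrite /cos_of_area up.
- exact: measurable_cos_of_area.
- exact: measurable_funTS.
Qed.

Lemma integral_sin_itv (u v : R) b0 b1 : u < v ->
  (\int[leb]_(th in [set` Interval (BSide b0 u) (BSide b1 v)]) (sin th)%:E =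
   (cos u - cos v)%:E)%E.
Proof.
move=> uv; rewrite integral_itv_bndoo; last first.
  apply: measurable_funTS; apply/measurable_EFinP.
  exact: continuous_measurable_fun (@continuous_sin R).
rewrite -(integral_itv_bndoo true false); last first.
  apply: measurable_funTS; apply/measurable_EFinP.
  exact: continuous_measurable_fun (@continuous_sin R).
have D (x : R) : is_derive x 1 (fun y : R => - cos y) (sin x).
  by rewrite -[sin x]opprK; apply: is_deriveN.
rewrite (@continuous_FTC2 _ _ (fun y : R => - cos y))//.
- by rewrite -EFinB opprK addrC.
- exact: continuous_subspaceT (@continuous_sin R).
- have C : continuous (fun y : R => - cos y).
    by move=> x; apply: continuousN; exact: continuous_cos.
  split=> [x _||]; first by case: (D x).
  + exact/cvg_at_right_filter/C.
  + exact/cvg_at_left_filter/C.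
- by move=> x _; rewrite derive1E; case: (D x).
Qed.

(** The left side is the integral of the sine between two arccosines, hence a difference of two
    cosines, which is the length of []a, b]] clipped to []-1, 1[]. *)
Lemma cos_measure_itv (a b : R) : cos_measure (`]a, b] `&` U11) = leb (`]a, b] `&` U11).
Proof.
have mab : measurable (`]a, b]%classic : set (measurableTypeR R)) by exact: measurable_itv.
rewrite -integral_indic; [|exact: measurable_itv|exact: mab].
rewrite integral_cos_measure; last 2 first.
- by apply/measurable_EFinP; exact: measurable_indic.
- by move=> x; rewrite lee_fin.
set a' := Num.max a (-1); set b' := Num.min b 1.
have clip x : -1 < x < 1 -> (a < x <= b) = (a' < x <= b').
  move=> /andP[x1 x2]; rewrite /a' /b' gt_max le_min x1 (ltW x2).
  by rewrite !andbT.
have [ba|ab] := leP b' a'.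
  have E0 x : -1 < x < 1 -> (a < x <= b) = false.
    move=> xI; rewrite clip//; apply/negP => /andP[h1 h2].
    by move: (lt_le_trans (lt_le_trans h1 h2) ba); rewrite ltxx.
  have -> : `]a, b] `&` U11 = set0.
    by apply/seteqP; split=> // x [] /=; rewrite !in_itv/= => h1 /E0; rewrite h1.
  rewrite measure0 integral0_eq// => th _.
  rewrite /sin0pi; case: ifPn => [/cos_0pi thpi|_]; last by rewrite mule0.
  rewrite indicE; case: (boolP (cos th \in _)) => [|_]; last by rewrite mul0e.
  by rewrite inE/= in_itv/= E0.
have a1 : -1 <= a' by rewrite le_max lexx orbT.
have b1 : b' <= 1 by rewrite ge_min lexx orbT.
have aI : -1 <= a' <= 1 by rewrite a1 (le_trans (ltW ab)).
have bI : -1 <= b' <= 1 by rewrite b1 (le_trans a1 (ltW ab)).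
have Ka : acos a' \in `[0, pi] by rewrite in_itv/= acos_ge0// acos_lepi.
have Kb : acos b' \in `[0, pi] by rewrite in_itv/= acos_ge0// acos_lepi.
have Ca : cos (acos a') = a' by rewrite acosK// in_itv.
have Cb : cos (acos b') = b' by rewrite acosK// in_itv.
have ler_cos (x y : R) : x \in `[0, pi] -> y \in `[0, pi] -> (cos x <= cos y) = (y <= x).
  by move=> Kx Ky; rewrite !leNgt ltr_cos.
have uv : acos b' < acos a' by rewrite -ltr_cos// Ca Cb.
transitivity ((b' - a')%:E : \bar R).
  (* The large inequality [cos th <= b'] closes the interval on the left, except when [acos b' = 0],
     since [0] is outside []0, pi[]. *)
  rewrite -{1}Ca -{1}Cb -(integral_sin_itv (acos b' != 0) true uv) [RHS]integral_mkcond.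
  apply: eq_integral => th _; rewrite patchE /sin0pi indicE.
  have -> : (th \in [set` Interval (BSide (acos b' != 0) (acos b')) (BSide true (acos a'))]) =
      (0 < th < pi) && (a < cos th <= b).
    apply/idP/idP.
      rewrite inE/= itv_boundlr => /andP[h1 h2].
      have v2 : th < acos a' by move: h2; rewrite bnd_simp.
      have u1 : acos b' <= th.
        by move: h1; case: (acos b' != 0); rewrite bnd_simp => // /ltW.
      have th0 : 0 < th.
        have := acos_ge0 bI; rewrite le_eqVlt => /orP[/eqP E|/lt_le_trans]; last exact.
        by move: h1; rewrite -E eqxx/= bnd_simp.
      have thpi : th < pi := lt_le_trans v2 (acos_lepi aI).
      have thI : 0 < th < pi by rewrite th0.
      have thK : th \in `[0, pi] by rewrite in_itv/= !ltW.
      rewrite thI/= clip ?cos_0pi// -[X in X < _]Ca -[X in _ <= X]Cb.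
      by rewrite (ltr_cos thK Ka) (ler_cos _ _ thK Kb) v2.
    move=> /andP[thI]; rewrite clip ?cos_0pi//.
    have thK : th \in `[0, pi] by move: thI => /andP[? ?]; rewrite in_itv/= !ltW.
    rewrite -[X in X < _]Ca -[X in _ <= X]Cb (ltr_cos thK Ka) (ler_cos _ _ thK Kb) => /andP[v2 u1].
    rewrite inE/= itv_boundlr !bnd_simp; apply/andP; split=> //.
    have [E|_] := eqVneq (acos b') 0; rewrite bnd_simp//.
    by rewrite E; case/andP: thI.
  case: ifPn => thpi; last by rewrite mule0.
  rewrite (_ : (cos th \in _) = (a < cos th <= b)).
    by rewrite /=; case: (_ < _ <= _); rewrite ?mul1e ?mul0e.
  by apply/idP/idP; rewrite inE/= in_itv.
(* The right end is open exactly when [b' = 1], which []-1, 1[] excludes. *)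
have -> : `]a, b] `&` U11 = [set` Interval (BRight a') (BSide (b' == 1) b')].
  apply/seteqP; split=> x /=.
    rewrite in_itv/= => -[h1]; rewrite in_itv/= => h2.
    move: h1; rewrite clip// itv_boundlr bnd_simp => /andP[-> h3]/=.
    have [E|_] := eqVneq b' 1; rewrite bnd_simp//.
    by rewrite E; case/andP: h2.
  rewrite itv_boundlr bnd_simp => /andP[h1 h2].
  have xb : x <= b' by move: h2; case: (b' == 1); rewrite bnd_simp => // /ltW.
  have xI : -1 < x < 1.
    rewrite (le_lt_trans a1 h1)/=; move: h2.
    have [->|bn1] := eqVneq b' 1; rewrite bnd_simp// => h2.
    by rewrite (le_lt_trans h2)// lt_neqAle bn1.
  by rewrite !in_itv/= clip// h1.
rewrite lebesgue_measure_itv/=.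
have -> : ((a'%:E < (b'%:E : \bar R))%E) = true by rewrite lte_fin.
by rewrite -EFinB.
Qed.

(** Uniqueness of Lebesgue measure concerns the whole line, so [cos_measure] on []-1, 1[] is glued
    to Lebesgue measure on the complement. *)
Lemma lebesgue_cos_measure (A : set (measurableTypeR R)) : measurable A -> A `<=` U11 ->
  leb A = cos_measure A.
Proof.
move=> mA AU.
have mU : measurable U11 by exact: measurable_itv.
pose m' := measure_add (mrestr cos_measure mU) (mrestr leb (measurableC mU)).
have m'E X : m' X = (cos_measure (X `&` U11) + leb (X `&` ~` U11))%E.
  exact: measure_addE.
have -> : leb A = m' A.
  apply: lebesgue_measure_unique => // _ [[a b]] _ <-.
  apply/esym/(etrans (m'E _)); rewrite cos_measure_itv.
  have mab : measurable (`]a, b]%classic : set (measurableTypeR R)) by exact: measurable_itv.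
  by rewrite [RHS](measureDI leb mab mU) addeC setDE.
rewrite m'E (setIidl AU) (_ : A `&` ~` U11 = set0).
  by rewrite measure0 adde0.
by apply/seteqP; split=> // x [/AU].
Qed.

Lemma cos_substitution (F : R -> \bar R) : measurable_fun setT F ->
  (forall x, 0 <= F x)%E ->
  (\int[leb]_(x in U11) F x =
   \int[leb]_th (F (cos th) * (sin0pi th)%:E))%E.
Proof.
move=> mF F0; rewrite -integral_cos_measure//.
by apply: eq_measure_integral => A mA AU; exact: lebesgue_cos_measure.
Qed.

Lemma cos_substitution_indic (F : R -> \bar R) : measurable_fun setT F ->
  (forall x, 0 <= F x)%E ->
  (\int[leb]_x (F x * (\1_U11 x)%:E) =
   \int[leb]_th (F (cos th) * (sin0pi th)%:E))%E.
Proof.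
move=> mF F0; rewrite -cos_substitution// [RHS]integral_mkcond.
by apply: eq_integral => x _; rewrite patchE indicE; case: ifPn; rewrite ?mule1 ?mule0.
Qed.

Definition cos2 (z : plane R) : plane R := (cos z.1, cos z.2).

Lemma measurable_cos2 : measurable_fun setT cos2.
Proof.
apply/measurable_fun_pairP; split.
  exact: (measurableT_comp measurable_cos measurable_fst).
exact: (measurableT_comp measurable_cos measurable_snd).
Qed.

Lemma measurable_indicU11 : measurable_fun setT (\1_U11 : measurableTypeR R -> R).
Proof. by apply: measurable_indic; exact: measurable_itv. Qed.

(** Tonelli and one substitution per variable; [K] is the integrand once the second variable is
    substituted. *)
Lemma ge0_cos_substitution2 (H : plane R -> \bar R) : measurable_fun setT H ->
  (forall z, 0 <= H z)%E ->
  (\int[J]_z (H z * (\1_U11 z.1 * \1_U11 z.2)%:E) =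
   \int[J]_z (H (cos2 z) * (sin0pi z.1 * sin0pi z.2)%:E))%E.
Proof.
move=> mH H0.
pose K (z : plane R) := (H (z.1, cos z.2) * (sin0pi z.2)%:E)%E.
have mK : measurable_fun setT K.
  apply: emeasurable_funM.
    apply: (measurableT_comp mH); apply/measurable_fun_pairP; split.
      exact: measurable_fst.
    exact: (measurableT_comp measurable_cos measurable_snd).
  apply/measurable_EFinP.
  exact: (measurableT_comp measurable_sin0pi measurable_snd).
have K0 z : (0 <= K z)%E by rewrite mule_ge0// lee_fin sin0pi_ge0.
rewrite fubini_tonelli1; last 2 first.
- apply: emeasurable_funM => //; apply/measurable_EFinP/measurable_funM.
    exact: (measurableT_comp measurable_indicU11 measurable_fst).
  exact: (measurableT_comp measurable_indicU11 measurable_snd).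
- by move=> z; rewrite mule_ge0// lee_fin mulr_ge0.
rewrite fubini_tonelli1; last 2 first.
- apply: emeasurable_funM; first exact: measurableT_comp mH measurable_cos2.
  apply/measurable_EFinP/measurable_funM.
    exact: (measurableT_comp measurable_sin0pi measurable_fst).
  exact: (measurableT_comp measurable_sin0pi measurable_snd).
- by move=> z; rewrite mule_ge0// lee_fin mulr_ge0// sin0pi_ge0.
have mKF : measurable_fun setT (fubini_F leb K).
  exact: measurable_fun_fubini_tonelli_F.
transitivity (\int[leb]_x (fubini_F leb K x * (\1_U11 x)%:E))%E.
  apply: eq_integral => x _; rewrite /fubini_F.
  under eq_integral do rewrite /= mulrC EFinM muleA.
  rewrite ge0_integralZr//; last 2 first.
  - apply: emeasurable_funM; first exact: measurableT_comp mH (pair1_measurable x).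
    by apply/measurable_EFinP; exact: measurable_indicU11.
  - by move=> y _; rewrite mule_ge0// lee_fin.
  congr (_ * _)%E; rewrite -(cos_substitution_indic (F := fun y => H (x, y)))//.
  exact: measurableT_comp mH (pair1_measurable x).
rewrite cos_substitution_indic//; last by move=> x; exact: integral_ge0.
apply: eq_integral => th _; rewrite /fubini_F -ge0_integralZr//; last 2 first.
- exact: measurableT_comp mK (pair1_measurable _).
- by rewrite lee_fin sin0pi_ge0.
by apply: eq_integral => th' _; rewrite /K /= [in RHS]mulrC EFinM muleA.
Qed.

Lemma cos_substitution2 (H : plane R -> R) : measurable_fun setT H ->
  (\int[J]_z (H z * (\1_U11 z.1 * \1_U11 z.2))%:E =
   \int[J]_z (H (cos2 z) * (sin0pi z.1 * sin0pi z.2))%:E)%E.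
Proof.
move=> mH.
have P (h w : R) : 0 <= w -> maxe (h * w)%:E 0 = (maxe h%:E 0 * w%:E)%E.
  by move=> w0; rewrite -!EFin_max -EFinM maxr_pMl// mul0r.
have N (h w : R) : 0 <= w -> maxe (- (h * w)%:E)%E 0 = (maxe (- h%:E)%E 0 * w%:E)%E.
  by move=> w0; rewrite -EFinN -mulNr P.
have w1 z : 0 <= \1_U11 z.1 * \1_U11 z.2 :> R by rewrite mulr_ge0.
have w2 (z : plane R) : 0 <= sin0pi z.1 * sin0pi z.2 by rewrite mulr_ge0// sin0pi_ge0.
rewrite integralE [RHS]integralE; congr (_ - _)%E.
- under eq_integral do rewrite funeposE P//.
  under [RHS]eq_integral do rewrite funeposE P//.
  rewrite (ge0_cos_substitution2 (H := fun z => maxe (H z)%:E 0)) //.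
  + by apply: measurable_maxe => //; exact/measurable_EFinP.
  + by move=> z; rewrite le_max lexx orbT.
- under eq_integral do rewrite funenegE N//.
  under [RHS]eq_integral do rewrite funenegE N//.
  rewrite (ge0_cos_substitution2 (H := fun z => maxe (- (H z)%:E)%E 0)) //.
  + apply: measurable_maxe => //; apply: measurableT_comp => //.
    exact/measurable_EFinP.
  + by move=> z; rewrite le_max lexx orbT.
Qed.

End CosineSubstitution.

(** * Chebyshev test functions *)

Section ChebyshevPrimitives.
Variable R : realType.
Implicit Types (m p : nat) (th x : R).

(* In the variable [x = cos th], [- cheb_prim p.+1 m] is a primitive of
   [cheb_prim p m], and [- cheb_prim 0 m] one of [T_m w]. *)
Fixpoint cheb_prim p m th : R :=
  if p is p'.+1 then (cheb_prim p' m.-1 th - cheb_prim p' m.+1 th) / (2 * m%:R)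
  else sin (m%:R * th) / m%:R.

(* Common form of [Gamma 0 0] ([p] even) and [Gamma 1 (-1)] ([p] odd). *)
Definition gam p (m : R) : R := (\prod_(n < p.+1) (m - p%:R + 2 * n%:R))^-1.

Lemma gam_gt0 p m : (p < m)%N -> 0 < gam p m%:R.
Proof.
move=> pm; rewrite invr_gt0; apply: prodr_gt0 => n _.
by rewrite ltr_wpDr ?mulr_ge0// subr_gt0 ltr_nat.
Qed.

(** The products for [m - 1] and [m + 1] share [p] factors; the remaining ones, [m - 1 - p] and
    [m + 1 + p], add up to [2 m]. *)
Lemma gamS p m : (p.+1 < m)%N ->
  gam p.+1 m%:R = (gam p m.-1%:R + gam p m.+1%:R) / (2 * m%:R).
Proof.
case: m => // m; rewrite ltnS => pm.
have P1 : 0 < \prod_(n < p.+1) (m%:R - p%:R + 2 * n%:R) :> R.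
  by rewrite -invr_gt0; exact: gam_gt0.
have P2 : 0 < \prod_(n < p.+1) (m.+2%:R - p%:R + 2 * n%:R) :> R.
  by rewrite -invr_gt0; apply: gam_gt0; rewrite ltnW// ltnW// ltnS ltnS ltnW.
move: P1 P2; rewrite /gam /=.
rewrite big_ord_recl big_ord_recr [X in _ -> _ -> X^-1 = _]big_ord_recl.
rewrite [X in _ -> _ -> (_ * X)^-1 = _]big_ord_recr/=.
set Q1 := \prod_(i < p) _; set Q2 := \prod_(i < p) _; set Q3 := \prod_(i < p) _.
have Q12 : Q2 = Q1.
  by apply: eq_bigr => i _; rewrite /bump leq0n/= add1n -!natr1; ring.
have Q13 : Q3 = Q1.
  by apply: eq_bigr => i _; rewrite /bump leq0n/= add1n -!natr1; ring.
rewrite Q12 Q13 /bump leq0n/= add1n => h1 h2.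
have mp : 0 < (m%:R - p%:R : R) by rewrite subr_gt0 ltr_nat.
have Q10 : 0 < Q1 by move: h1; rewrite mulr0 addr0 pmulr_rgt0.
rewrite -!natr1 !mulr0 !addr0.
have p0 : 0 <= (p%:R : R) by [].
field; rewrite !gt_eqF//; try lra.
Qed.

(** Under the triangle inequality the recursion of [cheb_prim] becomes that of [gam]. This is the
    origin of the reciprocal products in the theorem. *)
Lemma cheb_prim_le p m th : (p < m)%N -> `|cheb_prim p m th| <= gam p m%:R.
Proof.
elim: p m => [|p IH] m pm /=.
  rewrite /gam big_ord1 mulr0 addr0 subr0 normrM normfV normr_nat.
  by rewrite ler_piMl ?invr_ge0// ler_norml sin_geN1 sin_le1.
rewrite gamS// normrM normfV (ger0_norm (_ : 0 <= 2 * m%:R))// ler_wpM2r ?invr_ge0//.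
apply: le_trans (ler_normB _ _) _; apply: lerD; apply: IH.
  by case: m pm.
by rewrite ltnW// ltnW.
Qed.

Lemma sin_mul_le m th : `|sin (m%:R * th)| <= m%:R * `|sin th|.
Proof.
elim: m => [|m IH]; first by rewrite !mul0r sin0 normr0.
rewrite -natr1 !mulrDl !mul1r sinD; apply: le_trans (ler_normD _ _) _.
apply: lerD; rewrite normrM; last by rewrite ler_piMl// ler_norml cos_geN1 cos_le1.
by apply: le_trans IH; rewrite ler_piMr// ler_norml cos_geN1 cos_le1.
Qed.

(** Vanishing at [0] and [pi] at the rate of the sine is what [continuous_via_acos] asks for; the
    size of [C] does not matter. *)
Lemma cheb_prim_sin p m : exists C, forall th, `|cheb_prim p m th| <= C * `|sin th|.
Proof.
elim: p m => [|p IH] m /=.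
  (* This is [1], or [0] when [m = 0], where [cheb_prim] is [0] too. *)
  exists (m%:R / m%:R) => th; rewrite normrM normfV normr_nat mulrAC.
  by rewrite ler_wpM2r ?invr_ge0// sin_mul_le.
have [[C1 H1] [C2 H2]] := (IH m.-1, IH m.+1).
exists ((C1 + C2) / (2 * m%:R)) => th.
rewrite normrM normfV (ger0_norm (_ : 0 <= 2 * m%:R))// mulrAC ler_wpM2r ?invr_ge0//.
by apply: le_trans (ler_normB _ _) _; rewrite mulrDl lerD.
Qed.

Lemma is_derive_cheb_prim0 m th : (0 < m)%N ->
  is_derive th 1 (cheb_prim 0 m) (cos (m%:R * th)).
Proof.
move=> m0; have mn0 : m%:R != 0 :> R by rewrite pnatr_eq0 -lt0n.
have D1 : is_derive th 1 (fun t : R => m%:R * t) m%:R.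
  have := is_deriveZ m%:R (is_derive_id th (1 : R)).
  by rewrite /GRing.scale/= mulr1.
have D2 := is_derive1_comp (is_derive_sin (m%:R * th)) D1.
have := is_deriveZ m%:R^-1 D2.
rewrite /GRing.scale/= [m%:R^-1 * _]mulrC mulrK ?unitfE//.
rewrite [X in is_derive _ _ X _ -> _](_ : _ = cheb_prim 0 m)//.
by apply/funext => t; exact: mulrC.
Qed.

(** The base case is [cos ((m - 1) th) - cos ((m + 1) th) = 2 sin th sin (m th)]; the factor
    [sin th] then passes through the linear recursion. The bound on [p] keeps every frequency that
    is met positive. *)
Lemma is_derive_cheb_primS p m th : (p.+1 < m)%N ->
  is_derive th 1 (cheb_prim p.+1 m) (sin th * cheb_prim p m th).
Proof.
have gen (u v du dv c : R) (U V W : R -> R) :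
    is_derive th 1 U du -> is_derive th 1 V dv ->
    (forall t, W t = (U t - V t) / c) -> is_derive th 1 W ((du - dv) / c).
  move=> DU DV WE; have := is_deriveZ c^-1 (is_deriveB DU DV).
  rewrite /GRing.scale/= mulrC.
  rewrite [X in is_derive _ _ X _ -> _](_ : _ = W)//.
  by apply/funext => t /=; rewrite WE fctE /GRing.scale/= mulrC.
elim: p m => [|p IH] m pm.
  case: m pm => // m; rewrite ltnS => m0.
  have D1 := is_derive_cheb_prim0 th m0.
  have D2 := is_derive_cheb_prim0 th (isT : (0 < m.+2)%N).
  have := gen 0 0 _ _ (2 * m.+1%:R) _ _ (cheb_prim 1 m.+1) D1 D2 (fun=> erefl).
  congr is_derive => /=.
  have -> : m%:R * th = m.+1%:R * th - th by rewrite -natr1; ring.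
  have -> : m.+2%:R * th = m.+1%:R * th + th by rewrite -[m.+2%:R]natr1; ring.
  rewrite cosB cosD; by field; rewrite addrC natr1 pnatr_eq0.
case: m pm => // m; rewrite ltnS => pm.
have D1 := IH _ pm.
have D2 : is_derive th 1 (cheb_prim p.+1 m.+2) (sin th * cheb_prim p m.+2 th).
  by apply: IH; rewrite ltnW// ltnW.
have := gen 0 0 _ _ (2 * m.+1%:R) _ _ (cheb_prim p.+2 m.+1) D1 D2 (fun=> erefl).
by congr is_derive; rewrite /= -mulrBr mulrA.
Qed.

End ChebyshevPrimitives.

(** * Functions of the arccosine extended by zero *)

Section ThroughArccos.
Variable R : realType.
Implicit Types (u v : R -> R) (x : R).

Definition via_acos u x : R := if -1 < x < 1 then u (acos x) else 0.

Lemma acos_0pi x : -1 < x < 1 -> 0 < acos x < pi.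
Proof. by move=> /andP[h1 h2]; rewrite acos_gt0 ?acos_ltpi ?h1 ?h2 ?ltW. Qed.

Lemma out_m11 x : ~~ (-1 < x < 1) -> x <= -1 \/ 1 <= x.
Proof. by rewrite negb_and -!leNgt => /orP. Qed.

Lemma near_m11 x : -1 < x < 1 -> \forall y \near x, -1 < y < 1.
Proof. by move=> h; have := @near_in_itvoo R (-1) 1 x; rewrite in_itv/= => /(_ h). Qed.

(** The bound becomes [|C| sqrt (1 - y^2)]. This is continuous and, square roots of negative numbers
    being [0], it vanishes at and beyond the end points, where it squeezes the function. *)
Lemma continuous_via_acos u C :
  (forall th, 0 < th < pi -> {for th, continuous u}) ->
  (forall th, 0 < th < pi -> `|u th| <= C * `|sin th|) ->
  continuous (via_acos u).
Proof.
move=> cu uC x.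
have bnd (y : R) : `|via_acos u y| <= `|C| * Num.sqrt (1 - y ^+ 2).
  rewrite /via_acos; case: ifPn => [y1|_]; last by rewrite normr0 mulr_ge0.
  apply: le_trans (uC _ (acos_0pi y1)) _.
  have yI : -1 <= y <= 1 by case/andP: y1 => ? ?; rewrite !ltW.
  by rewrite sin_acos// (ger0_norm (sqrtr_ge0 _)) ler_wpM2r// ler_norm.
have [x1|x1] := boolP (-1 < x < 1).
  have E : \forall y \near x, u (acos y) = via_acos u y.
    by near do rewrite /via_acos ifT//; exact: near_m11.
  rewrite /continuous_at {2}/via_acos x1.
  apply: (cvg_trans _ (cvg_comp _ _ (continuous_acos x1) (cu _ (acos_0pi x1)))).
  by apply: near_eq_cvg.
rewrite /continuous_at.
have -> : via_acos u x = 0 by rewrite /via_acos (negbTE x1).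
have s0 : Num.sqrt (1 - x ^+ 2) = 0.
  apply/eqP; rewrite sqrtr_eq0 subr_le0.
  by case: (out_m11 x1) => h; nra.
have sq : (fun y => `|C| * Num.sqrt (1 - y ^+ 2)) y @[y --> x] --> 0.
  rewrite -[X in _ --> X](mulr0 `|C|) -s0; apply: cvgMr.
  have c1 : 1 - y ^+ 2 @[y --> (x : R)] --> 1 - x ^+ 2.
    by apply: cvgB; [exact: cvg_cst|exact: exprn_continuous].
  exact: (cvg_comp _ _ c1 (@sqrt_continuous R _)).
apply/norm_cvg0P.
apply: (squeeze_cvgr _ (cvg_cst 0) sq).
by apply: nearW => y; rewrite normr_ge0 bnd.
Unshelve. all: by end_near. Qed.

(* At the end points the derivative vanishes because, by the mean value
   theorem, difference quotients there are values of [via_acos v] nearby. *)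
Lemma is_derive_via_acos u v x :
  (forall th, 0 < th < pi -> is_derive th 1 u (- (sin th * v th))) ->
  continuous (via_acos u) -> continuous (via_acos v) ->
  is_derive x 1 (via_acos u) (via_acos v x).
Proof.
move=> du cu cv.
have inner (y : R) : -1 < y < 1 -> is_derive y 1 (via_acos u) (via_acos v y).
  move=> y1; have y2 := acos_0pi y1.
  have D := is_derive1_comp (du _ y2) (is_derive1_acos y1).
  have E : \forall z \near y, (u \o @acos R) z = via_acos u z.
    by near do rewrite /via_acos ifT//; exact: near_m11.
  have := near_eq_is_derive E D; congr is_derive.
  have yI : -1 <= y <= 1 by case/andP: y1 => ? ?; rewrite !ltW.
  have s0 : Num.sqrt (1 - y ^+ 2) != 0.
    by rewrite -sin_acos// gt_eqF// sin_gt0_pi.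
  rewrite /via_acos y1 mulrNN sin_acos//.
  by rewrite mulrAC mulfV// mul1r.
have [x1|x1] := boolP (-1 < x < 1); first exact: inner.
have vx0 : via_acos v x = 0 by rewrite /via_acos (negbTE x1).
have ux0 : via_acos u x = 0 by rewrite /via_acos (negbTE x1).
have u1 : via_acos u 1 = 0 by rewrite /via_acos ltxx andbF.
have um1 : via_acos u (-1) = 0 by rewrite /via_acos ltxx.
(* For [y] inside, apply the mean value theorem between [y] and the end point on the side of [x]:
   [via_acos u] vanishes there, and it is at least as close to [y] as [x] is. *)
have mv (y : R) : exists c, `|c - x| <= `|y - x| /\ `|via_acos u y| <= `|via_acos v c| * `|y - x|.
  have [y1|y1] := boolP (-1 < y < 1); last first.
    exists x; rewrite subrr normr0 {1}/via_acos (negbTE y1) normr0.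
    by split=> //; rewrite mulr_ge0.
  have [xm|xp] := out_m11 x1.
  - have ym : -1 < y by case/andP: y1.
    have [||c] := MVT ym (f := via_acos u) (df := via_acos v).
    + move=> z; rewrite in_itv/= => /andP[z1 z2]; apply: inner; case/andP: y1 => ? ?; apply/andP; split; lra.
    + exact: continuous_subspaceT.
    rewrite in_itv/= um1 subr0 => /andP[c1 c2] ->; exists c; split.
      by rewrite !ger0_norm; lra.
    by rewrite normrM ler_wpM2l// !ger0_norm; lra.
  - have yp : y < 1 by case/andP: y1.
    have [||c] := MVT yp (f := via_acos u) (df := via_acos v).
    + move=> z; rewrite in_itv/= => /andP[z1 z2]; apply: inner; case/andP: y1 => ? ?; apply/andP; split; lra.
    + exact: continuous_subspaceT.
    rewrite in_itv/= u1 sub0r => /andP[c1 c2] E; exists c; split.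
      by rewrite !ler0_norm; lra.
    by rewrite -normrN E normrM ler_wpM2l// [leRHS]distrC !ger0_norm; lra.
apply/dq_cvg_derive; rewrite vx0; apply/cvgrPdist_le => e e0.
have /cvgrPdist_le/(_ e e0) := cv x; rewrite vx0 => /nbhs_ballP[r /= r0 Hr].
rewrite near_withinE; apply/nbhs_ballP; exists r => //= h.
rewrite /ball/= sub0r normrN => hr h0.
have xhx : x + h - x = h by ring.
have [c [cx uc]] := mv (x + h); rewrite xhx in cx uc.
rewrite sub0r normrN /dq ux0 subr0 normrM normfV ler_pdivrMr ?normr_gt0//.
apply: le_trans uc _; rewrite ler_wpM2r//.
have := Hr c; rewrite /ball/= distrC sub0r normrN; apply.
exact: le_lt_trans cx hr.
Unshelve. all: by end_near. Qed.

End ThroughArccos.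

Section ChebyshevTest.
Variable R : realType.
Implicit Types (k i N q : nat) (th x : R).

(* The difference of two frequencies of equal parity vanishes where [sin] does,
   so that the last derivative, [(T_i - T_{i+2N}) w] up to sign, is continuous
   with value [0] at the end points. *)
Definition cheb_test k i N q th : R :=
  if (q <= k)%N then
    (-1) ^+ q * (cheb_prim (k - q) i th - cheb_prim (k - q) (i + 2 * N) th)
  else (-1) ^+ k.+1 * ((cos (i%:R * th) - cos ((i + 2 * N)%:R * th)) / sin th).

Lemma continuous_cheb_prim p m : continuous (@cheb_prim R p m).
Proof.
elim: p m => [|p IH] m th /=; apply: cvgMl; last by apply: cvgB; exact: IH.
apply: (@continuous_comp _ _ _ (fun t : R => m%:R * t) sin).
  by apply: cvgMr; exact: cvg_id.
exact: continuous_sin.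
Qed.

Lemma continuous_cosM (m : nat) : continuous (fun th : R => cos (m%:R * th)).
Proof.
move=> th; apply: (@continuous_comp _ _ _ (fun t : R => m%:R * t) cos).
  by apply: cvgMr; exact: cvg_id.
exact: continuous_cos.
Qed.

(** The difference is [2 sin ((i + N) th) sin (N th)]. Of the two factors [|sin th|], one pays for
    the division in [cheb_test], the other gives continuity at the end points. *)
Lemma cos_diff_le i N th :
  `|cos (i%:R * th) - cos ((i + 2 * N)%:R * th)| <=
  (2 * (i + N)%:R * N%:R) * (`|sin th| * `|sin th|).
Proof.
have -> : i%:R * th = (i + N)%:R * th - N%:R * th by rewrite natrD; ring.
have -> : (i + 2 * N)%:R * th = (i + N)%:R * th + N%:R * th.
  by rewrite mul2n -addnn !natrD; ring.
rewrite cosB cosD (_ : _ - _ = 2 * (sin ((i + N)%:R * th) * sin (N%:R * th))); last by ring.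
rewrite 2!normrM normr_nat -!mulrA ler_pM2l// [X in _ <= X](_ : _ =
  ((i + N)%:R * `|sin th|) * (N%:R * `|sin th|)); last by ring.
by rewrite ler_pM// sin_mul_le.
Qed.

Lemma is_derive_cheb_test k i N q th : (k < i)%N -> (q <= k)%N -> 0 < th < pi ->
  is_derive th 1 (cheb_test k i N q) (- (sin th * cheb_test k i N q.+1 th)).
Proof.
move=> ki qk thpi; have s0 : sin th != 0 by rewrite gt_eqF// sin_gt0_pi.
have ki' : (k < i + 2 * N)%N by rewrite ltn_addr.
have gen (du dv c : R) (U V W : R -> R) :
    is_derive th 1 U du -> is_derive th 1 V dv ->
    (forall t, W t = c * (U t - V t)) -> is_derive th 1 W (c * (du - dv)).
  move=> DU DV WE; have := is_deriveZ c (is_deriveB DU DV).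
  rewrite [X in is_derive _ _ X _ -> _](_ : _ = W)//.
  by apply/funext => t; rewrite WE.
have WE t : cheb_test k i N q t =
    (-1) ^+ q * (cheb_prim (k - q) i t - cheb_prim (k - q) (i + 2 * N) t).
  by rewrite /cheb_test qk.
move: qk; rewrite leq_eqVlt => /orP[/eqP qk|qk].
  move: WE; rewrite qk subnn => WE.
  have i0 : (0 < i)%N by exact: leq_ltn_trans ki.
  have i'0 : (0 < i + 2 * N)%N by exact: leq_ltn_trans ki'.
  have := gen _ _ _ _ _ _ (is_derive_cheb_prim0 th i0) (is_derive_cheb_prim0 th i'0) WE.
  congr is_derive; rewrite /cheb_test ltnn exprS; field.
  exact: s0.
have [p pE] : exists p, (k - q = p.+1)%N
  by move: qk; rewrite -subn_gt0; case: (k - q)%N => // p _; exists p.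
have pk : (p.+1 <= k)%N by rewrite -pE leq_subr.
have D1 := is_derive_cheb_primS th (leq_ltn_trans pk ki).
have D2 := is_derive_cheb_primS th (leq_ltn_trans pk ki').
move: WE; rewrite pE => WE; have := gen _ _ _ _ _ _ D1 D2 WE.
congr is_derive; rewrite /cheb_test qk (_ : (k - q.+1 = p)%N); last by rewrite subnS pE.
by rewrite exprS; ring.
Qed.

Lemma continuous_cheb_test k i N q : (q <= k.+1)%N ->
  continuous (via_acos (cheb_test k i N q)).
Proof.
move=> qk; have [q1|q1] := leqP q k.
  have [C1 H1] := cheb_prim_sin R (k - q) i.
  have [C2 H2] := cheb_prim_sin R (k - q) (i + 2 * N).
  apply: (@continuous_via_acos _ _ (C1 + C2)).
    move=> th _; rewrite /cheb_test q1 => /=; apply: cvgMr.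
    by apply: cvgB; exact: continuous_cheb_prim.
  move=> th _; rewrite /cheb_test q1 normrM normrX normrN1 expr1n mul1r.
  by apply: le_trans (ler_normB _ _) _; rewrite mulrDl lerD.
apply: (@continuous_via_acos _ _ (2 * (i + N)%:R * N%:R)) => th thpi;
    have s0 : sin th != 0 by rewrite gt_eqF// sin_gt0_pi.
  rewrite /cheb_test leqNgt q1/=; apply: cvgMr; apply: cvgM.
    by apply: cvgB; exact: continuous_cosM.
  by apply: cvgV => //; exact: continuous_sin.
rewrite /cheb_test leqNgt q1/= normrM normrX normrN1 expr1n mul1r normrM normfV.
by rewrite ler_pdivrMr ?normr_gt0// -[X in _ <= X]mulrA cos_diff_le.
Qed.

Lemma test_cheb k i N : (k < i)%N ->
  test_chain k.+1 (-1) 1 (fun q => via_acos (cheb_test k i N q)).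
Proof.
move=> ki; split.
- move=> q qk x; apply: is_derive_via_acos.
  + by move=> th; exact: is_derive_cheb_test.
  + by apply: continuous_cheb_test; exact: leqW.
  + exact: continuous_cheb_test.
- by move=> q qk; exact: continuous_cheb_test.
- move=> q qk x xI; rewrite /via_acos; case: ifPn => // /andP[h1 h2].
  by case/negP: xI; rewrite !ltW.
Qed.

Lemma cheb_test_le k i N x : (k < i)%N ->
  `|via_acos (cheb_test k i N 0) x| <= gam k i%:R + gam k (i + 2 * N)%:R :> R.
Proof.
move=> ki; have ki' : (k < i + 2 * N)%N by rewrite ltn_addr.
have g1 := gam_gt0 R ki; have g2 := gam_gt0 R ki'.
rewrite /via_acos; case: ifPn => _; last by rewrite normr0 ltW// addr_gt0.
rewrite /cheb_test subn0 mul1r; apply: le_trans (ler_normB _ _) _.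
by apply: lerD; exact: cheb_prim_le.
Qed.

Lemma test_scale n s t (phi : nat -> R -> R) (c : R) : 0 < c ->
  test_chain n s t phi ->
  test_chain n (s / c) (t / c) (fun q x => c ^+ q * phi q (c * x)).
Proof.
move=> c0 [dp cp sp]; split.
- move=> q qn x.
  have D1 : is_derive x 1 (fun y : R => c * y) c.
    by have := is_deriveZ c (is_derive_id x (1 : R)); rewrite /GRing.scale/= mulr1.
  have := is_deriveZ (c ^+ q) (is_derive1_comp (dp q qn (c * x)) D1).
  by rewrite /GRing.scale/= exprSr mulrAC mulrA.
- move=> q qn x; apply: cvgMr.
  apply: (@continuous_comp _ _ _ (fun y : R => c * y) (phi q)); last exact: cp.
  by apply: cvgMr; exact: cvg_id.
- move=> q qn x xst; rewrite sp ?mulr0//; apply: contra xst.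
  by rewrite ler_pdivrMr// ler_pdivlMr// [x * c]mulrC.
Qed.

End ChebyshevTest.

Section ClosedCore.
Variable R : realType.
Notation leb := (@lebesgue_measure R).
Notation J := (leb \x leb)%E.
Variables (M : R) (k l : nat) (F U : nat -> R -> R -> R).
Variables (nu : {finite_measure set (plane R) -> \bar R}).
Variable (m : R -> R -> R -> R -> R).
Hypothesis cF : forall x, -1 < x < 1 -> chain (-1) 1 l (fun q => F q x).
Hypothesis cU : forall y, -1 < y < 1 -> chain (-1) 1 k (fun p => U p ^~ y).
Hypothesis FU : F l = U 0%N.
Hypothesis iF : J.-integrable setT (EFin \o uncurry2 (F 0%N)).
Hypothesis incM : forall x x' y y', -1 < x -> x < x' -> x' < 1 ->
  -1 < y -> y < y' -> y' < 1 -> `|increment (U k) x x' y y'| <= M.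
Hypothesis inc_cvg : forall x x' y y', -1 < x -> x < x' -> x' < 1 ->
  -1 < y -> y < y' -> y' < 1 ->
  increment (U k) (x + e) (x' + e) (y + e) (y' + e) @[e --> 0^'+] --> m x x' y y'.
Hypothesis m_le : forall x x' y y', -1 < x -> x < x' -> x' < 1 ->
  -1 < y -> y < y' -> y' < 1 ->
  (`|m x x' y y'|%:E <= nu (`]x, x'] `*` `]y, y']))%E.

(* Dilation by [c n > 1] moves the supports into the open interval. *)
Lemma core_inequality_closed (phi psi : nat -> R -> R) (Cphi Cpsi : R) :
  test_chain k.+1 (-1) 1 phi -> test_chain l.+1 (-1) 1 psi ->
  (forall x, `|phi 0%N x| <= Cphi) -> (forall x, `|psi 0%N x| <= Cpsi) ->
  `|\int[J]_z (uncurry2 (F 0%N) z * tens (phi k.+1) (psi l.+1) z)|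
  <= Cphi * Cpsi * fine (nu setT).
Proof.
move=> Tphi Tpsi phiC psiC.
pose c (n : nat) : R := 1 + 1 / n.+1%:R.
have c1 n : 1 < c n by rewrite ltrDl divr_gt0.
have c0 n : 0 < c n by rewrite (lt_trans _ (c1 n)).
have c2 n : c n <= 2.
  by rewrite /c -[X in _ <= X]/(1 + 1) lerD2l ler_pdivrMr// mul1r ler1n.
have cc : c n @[n --> \oo] --> (1 : R).
  rewrite -[X in _ --> X]addr0; apply: cvgD; [exact: cvg_cst|exact: cvg_step].
have T n (r : nat) (chi : nat -> R -> R) : test_chain r.+1 (-1) 1 chi ->
    test_chain r.+1 (- (c n)^-1) (c n)^-1 (fun q x => c n ^+ q * chi q (c n * x)).
  by move=> Tchi; have := test_scale (c0 n) Tchi; rewrite mulN1r mul1r.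
have gen (r : nat) (chi : nat -> R -> R) (x : R) : test_chain r.+1 (-1) 1 chi ->
    c n ^+ r.+1 * chi r.+1 (c n * x) @[n --> \oo] --> chi r.+1 x.
  move=> Tchi; rewrite -[X in _ --> X]mul1r -(expr1n _ r.+1); apply: cvgM.
    exact: (cvg_comp _ _ cc (@exprn_continuous _ r.+1 _)).
  have cy : {for x, continuous (chi r.+1)} by apply: (test_continuous Tchi).
  have cx : c n * x @[n --> \oo] --> x.
    by rewrite -[X in _ --> X]mul1r; apply: cvgMl.
  exact: (cvg_comp _ _ cx cy).
have bnd (r : nat) (chi : nat -> R -> R) : test_chain r.+1 (-1) 1 chi ->
    exists C, forall (n : nat) x, `|c n ^+ r.+1 * chi r.+1 (c n * x)| <= C.
  move=> Tchi; have [_ [C HC]] := test_bounded Tchi (leqnn _).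
  exists (2 ^+ r.+1 * C) => n x; rewrite normrM ler_pM//.
  by rewrite normrX gtr0_norm// ler_pXn2r// nnegrE// ltW.
have lim : \int[J]_z (uncurry2 (F 0%N) z *
      tens (fun x => c n ^+ k.+1 * phi k.+1 (c n * x)) (fun x => c n ^+ l.+1 * psi l.+1 (c n * x)) z)
    @[n --> \oo] --> \int[J]_z (uncurry2 (F 0%N) z * tens (phi k.+1) (psi l.+1) z).
  apply: Rintegral_mul_tens_cvg => //.
  - by move=> n; exact: (test_bounded (T n _ _ Tphi) (leqnn _)).
  - by move=> n; exact: (test_bounded (T n _ _ Tpsi) (leqnn _)).
  - exact: bnd.
  - exact: bnd.
  - by move=> x; exact: gen.
  - by move=> x; exact: gen.
apply: (@ler_cvg_to _ _ _ _ _ _ _ _ (cvg_norm lim) (cvg_cst _)).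
apply: nearW => n.
have v1 : (c n)^-1 < 1 by rewrite invf_lt1.
have v2 : -1 < - (c n)^-1 by rewrite ltrN2.
(* Dilation keeps the bounds on the functions of order zero, so [Cphi] and [Cpsi] survive. *)
apply: (core_inequality v2 v1 cF cU FU iF incM inc_cvg m_le (T n _ _ Tphi) (T n _ _ Tpsi)).
- by move=> x; rewrite expr0 mul1r.
- by move=> x; rewrite expr0 mul1r.
Qed.

End ClosedCore.

(** * The Chebyshev coefficients *)

Section Interior.
Variable R : realType.
Implicit Types (f g : R -> R -> R) (h : R -> R) (x y : R).

Lemma derivable_in_interior h x : -1 < x < 1 -> derivable_in h x ->
  is_derive x 1 h (deriv_in h x).
Proof.
move=> x1 dh; apply/dq_cvg_derive.
have : diff_quot_in h x --> deriv_in h x by [].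
move=> /cvgrPdist_le H; apply/cvgrPdist_le => e /H.
rewrite /diff_quot_in /= 3!near_withinE => {}H.
have m0 : 0 < Num.min (1 - x) (x + 1) by rewrite lt_min; lra.
have /nbhs_ballP[r /= r0 Hr] := H.
apply/nbhs_ballP; exists (Num.min r (Num.min (1 - x) (x + 1))) => /=.
  by rewrite lt_min r0.
move=> d; rewrite /ball/= sub0r normrN !lt_min => /andP[dr /andP[d1 d2]] d0.
have := Hr (x + d); rewrite /ball/= opprD addNKr normrN => /(_ dr).
have n1 := ler_norm d; have n2 := ler_norm (- d); rewrite normrN in n2.
have xd : x + d - x = d by ring.
rewrite /dq xd; apply.
  by apply: contra_neq d0 => /(congr1 (fun z => z - x)); rewrite xd subrr.
by rewrite in_itv/=; lra.
Qed.

(* Derivatives within [-1, 1] are two-sided only in the interior. *)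
Definition on_square g x y : R :=
  if (-1 < x < 1) && (-1 < y < 1) then g x y else 0.

(** The rectangle is the middle cell of a grid of nine cells, whose variation is at least this one
    term. *)
Lemma vitali_increment_le g : vitali_bounded_variation g ->
  exists M, forall x x' y y', -1 < x -> x < x' -> x' < 1 ->
    -1 < y -> y < y' -> y' < 1 -> `|increment g x x' y y'| <= M.
Proof.
move=> [M HM]; exists M => x x' y y' x1 x2 x3 y1 y2 y3.
have part (u u' : R) : -1 < u -> u < u' -> u' < 1 -> itv_partition (-1) 1 [:: u; u'; 1].
  by move=> h1 h2 h3; split; rewrite /= ?h1 ?h2 ?h3 ?eqxx.
apply: le_trans (HM (vitali_variation g [:: x; x'; 1] [:: y; y'; 1]) _); last first.
  by exists [:: x; x'; 1], [:: y; y'; 1]; split=> //; exact: part.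
rewrite /vitali_variation /= !big_nat_recl// !big_geq//= !addr0.
have p (r : R) := normr_ge0 r.
have := p (increment g (-1) x (-1) y); have := p (increment g (-1) x y y').
have := p (increment g (-1) x y' 1); have := p (increment g x x' (-1) y).
have := p (increment g x x' y' 1); have := p (increment g x' 1 (-1) y).
have := p (increment g x' 1 y y'); have := p (increment g x' 1 y' 1).
lra.
Qed.

(** For small [e] all four corners stay in the open square, where clamping is the identity. *)
Lemma stieltjes_increment_cvg g mu : is_stieltjes_charge g mu ->
  forall x x' y y', -1 < x -> x < x' -> x' < 1 -> -1 < y -> y < y' -> y' < 1 ->
  increment (on_square g) (x + e) (x' + e) (y + e) (y' + e) @[e --> 0^'+] -->
  fine (mu (`]x, x'] `*` `]y, y'])).
Proof.
move=> H x x' y y' x1 x2 x3 y1 y2 y3.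
apply: cvg_trans (H x x' y y' (ltW x2) (ltW y2)).
apply: near_eq_cvg; near=> e.
have e0 : 0 < e by near: e; exact: nbhs_right_gt.
have ex : e < 1 - x' by near: e; apply: nbhs_right_lt; rewrite subr_gt0.
have ey : e < 1 - y' by near: e; apply: nbhs_right_lt; rewrite subr_gt0.
have cl z : -1 < z < 1 -> clamp z = z.
  move=> /andP[z1 z2]; rewrite /clamp (min_idPl (ltW z2)).
  by rewrite (max_idPr (ltW z1)).
have i1 : -1 < x + e < 1 by lra.
have i2 : -1 < x' + e < 1 by lra.
have i3 : -1 < y + e < 1 by lra.
have i4 : -1 < y' + e < 1 by lra.
by rewrite /increment /on_square !cl// i1 i2 i3 i4.
Unshelve. all: by end_near. Qed.

Lemma chain_on_square2 f k l x : partial_exists f k l -> -1 < x < 1 ->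
  chain (-1) 1 l (fun q => on_square (partial f 0 q) x).
Proof.
move=> [dy _] x1 q ql y y1.
have xI : x \in `[-1, 1] by move: x1 => /andP[? ?]; rewrite in_itv/= !ltW.
have yI : y \in `[-1, 1] by move: y1 => /andP[? ?]; rewrite in_itv/= !ltW.
have D := derivable_in_interior y1 (dy q ql x y xI yI).
have E : \forall z \near y, partial f 0 q x z = on_square (partial f 0 q) x z.
  by near do rewrite /on_square x1 ifT//; exact: near_m11.
by have := near_eq_is_derive E D; congr is_derive; rewrite /on_square x1 y1.
Unshelve. all: by end_near. Qed.

Lemma chain_on_square1 f k l y : partial_exists f k l -> -1 < y < 1 ->
  chain (-1) 1 k (fun p => on_square (partial f p l) ^~ y).
Proof.
move=> [_ dx] y1 p pk x x1.
have xI : x \in `[-1, 1] by move: x1 => /andP[? ?]; rewrite in_itv/= !ltW.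
have yI : y \in `[-1, 1] by move: y1 => /andP[? ?]; rewrite in_itv/= !ltW.
have D := derivable_in_interior x1 (dx p pk x y xI yI).
have E : \forall z \near x, partial f p l z y = on_square (partial f p l) z y.
  by near do rewrite /on_square y1 andbT ifT//; exact: near_m11.
by have := near_eq_is_derive E D; congr is_derive; rewrite /on_square x1 y1.
Unshelve. all: by end_near. Qed.

End Interior.

(** * The variation of the charge on the square *)

Section WeightedVariation.
Variable R : realType.
Variables (mu : {charge set (plane R) -> \bar R}) (P N : set (plane R)).
Variable muPN : hahn_decomposition mu P N.

Lemma measurable_Dsquare : measurable (@Dsquare R).
Proof. by apply: measurableX; exact: measurable_itv. Qed.

Lemma inve_sqrt_ge1 (x : R) : -1 <= x <= 1 ->
  (1 <= (Num.sqrt (1 - x ^+ 2))%:E^-1)%E.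
Proof.
move=> x1; rewrite inver; case: ifPn => [_|s0]; first exact: leey.
rewrite lee_fin invf_ge1; last by rewrite lt_def s0 sqrtr_ge0.
by rewrite -[leRHS]sqrtr1 ler_sqrt// gerBl sqr_ge0.
Qed.

Lemma charge_variation_le_weighted : stieltjes_coef_exists muPN 0 0 ->
  (charge_variation muPN (@Dsquare R) <= weighted_variation muPN)%E.
Proof.
move=> /integrableP[mw _].
have mD := measurable_Dsquare.
(* As [T_0 = 1], existence of the coefficient with [i = j = 0] contains the measurability of
   [omega]. *)
have mo : measurable_fun (@Dsquare R) (@omega R).
  move: mw; congr measurable_fun; apply/funext => z.
  by rewrite /chebT !mul0r cos0 mulr1 mul1e.
have o1 z : @Dsquare R z -> (1 <= omega z)%E.
  move=> [/= z1 z2]; rewrite in_itv/= in z1; rewrite in_itv/= in z2.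
  by rewrite /omega -[X in (X <= _)%E]mule1 lee_pmul// inve_sqrt_ge1.
rewrite /weighted_variation -[X in (X <= _)%E]mul1e -integral_cst//.
exact: ge0_le_integral.
Qed.

Lemma charge_variation_lty : (charge_variation muPN (@Dsquare R) < +oo)%E.
Proof. by rewrite ltey_eq fin_num_measure//; exact: measurable_Dsquare. Qed.

(** Restricted to the square so that its total mass is the quantity that [omega >= 1] compares with
    the weighted variation. *)
Definition square_variation : {finite_measure set (plane R) -> \bar R} :=
  mfrestr measurable_Dsquare charge_variation_lty.

Lemma charge_cell_le x x' y y' : -1 < x -> x < x' -> x' < 1 ->
  -1 < y -> y < y' -> y' < 1 ->
  (`|fine (mu (`]x, x'] `*` `]y, y']))|%:E <= square_variation (`]x, x'] `*` `]y, y']))%E.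
Proof.
move=> x1 x2 x3 y1 y2 y3.
have mc : measurable (`]x, x'] `*` `]y, y'] : set (plane R)).
  by apply: measurableX; exact: measurable_itv.
rewrite -[X in (X <= _)%E]/(`|(fine (mu (`]x, x'] `*` `]y, y'])))%:E|)%E fineK; last exact: fin_num_measure.
apply: le_trans (abse_charge_variation muPN mc) _.
rewrite /square_variation /= /mfrestr /mrestr setIidl//.
move=> z [/= z1 z2]; rewrite in_itv/= in z1; rewrite in_itv/= in z2.
by split; rewrite /= in_itv/=; lra.
Qed.

End WeightedVariation.

(** * Averaging *)

Section CosineMeans.
Variable R : realType.
Implicit Types (th : R) (i n : nat).

Definition cos_mean i n th : R :=
  n.+1%:R^-1 * \sum_(0 <= m < n.+1) cos ((i + 2 * m)%:R * th).

(** Each product is [2 sin th cos a = sin (a + th) - sin (a - th)]; the frequencies advance by [2],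
    so consecutive terms telescope. *)
Lemma sum_cos_telescope i n th :
  2 * sin th * \sum_(0 <= m < n) cos ((i + 2 * m)%:R * th) =
  sin ((i + 2 * n)%:R * th - th) - sin (i%:R * th - th).
Proof.
elim: n => [|n IH]; first by rewrite big_geq// mulr0 muln0 addn0 subrr.
rewrite big_nat_recr//= mulrDr IH.
have -> : (i + 2 * n.+1)%:R * th - th = (i + 2 * n)%:R * th + th.
  by rewrite mulnS addnCA natrD; ring.
rewrite (sinD _ th) sinB; ring.
Qed.

Lemma cos_mean_le1 i n th : `|cos_mean i n th| <= 1.
Proof.
rewrite /cos_mean normrM normfV normr_nat mulrC ler_pdivrMr// mul1r.
apply: le_trans (ler_norm_sum _ _ _) _.
have -> : n.+1%:R = \sum_(0 <= m < n.+1) (1 : R).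
  by rewrite sumr_const_nat subn0.
by apply: ler_sum => m _; rewrite ler_norml cos_geN1 cos_le1.
Qed.

Lemma cos_mean_cvg i th : sin th != 0 -> cos_mean i n th @[n --> \oo] --> (0 : R).
Proof.
move=> s0; apply/norm_cvg0P.
have c : (`|sin th|^-1 / n.+1%:R) @[n --> \oo] --> (0 : R) := cvg_step _.
apply: (squeeze_cvgr _ (cvg_cst 0) c).
apply: nearW => n; rewrite normr_ge0/= /cos_mean normrM normfV normr_nat mulrC.
rewrite ler_wpM2r ?invr_ge0// -[leRHS]mul1r ler_pdivlMr ?normr_gt0// mulrC -normrM.
rewrite -(@ler_pM2l _ 2)// -[X in X * `|_|](@normr_nat R 2) -normrM mulrA sum_cos_telescope.
apply: le_trans (ler_normB _ _) _; rewrite mulr1 -[leRHS]/(1 + 1).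
by apply: lerD; rewrite ler_norml sin_geN1 sin_le1.
Qed.

Lemma measurable_cosM (m : nat) : measurable_fun setT (fun th : R => cos (m%:R * th)).
Proof. exact: continuous_measurable_fun (@continuous_cosM R m). Qed.

End CosineMeans.

Section ChebyshevCoefficients.
Variable R : realType.
Notation leb := (@lebesgue_measure R).
Notation J := (leb \x leb)%E.
Local Notation Th := (@theta_domain R).
Local Notation U11 := (`]-1, 1[%classic : set (measurableTypeR R)).
Variable f : R -> R -> R.
Hypothesis exf : forall i j, cheb_coef_exists f 0 0 i j.

Let fc (z : plane R) := f (cos z.1) (cos z.2).
Let ci i j (z : plane R) := cheb_integrand f 0 0 i j z.
Let I i j := \int[J]_(z in Th) ci i j z.

Let ciE i j z : ci i j z = fc z * cos (i%:R * z.1) * cos (j%:R * z.2).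
Proof. by []. Qed.

Lemma measurable_theta_domain : measurable Th.
Proof. by apply: measurableX; exact: measurable_itv. Qed.

Let mTh := measurable_theta_domain.

Let ici i j : J.-integrable Th (EFin \o ci i j).
Proof. exact: exf. Qed.

Let ifc : J.-integrable Th (EFin \o fc).
Proof.
have := exf 0 0; congr (_.-integrable _ _); apply/funext => z /=.
by rewrite /cheb_integrand !mul0r cos0 !mulr1.
Qed.

Let mfc : measurable_fun Th fc.
Proof. by apply/measurable_EFinP; exact: measurable_int ifc. Qed.

Lemma measurable_via_acos_id : measurable_fun setT (@via_acos R id : measurableTypeR R -> measurableTypeR R).
Proof.
have -> : @via_acos R id = (@acos R) \_ U11.
  apply/funext => x; rewrite /via_acos patchE.
  by congr (if _ then _ else _); apply/idP/idP; rewrite inE/= in_itv.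
apply: (measurable_restrictT _ _).1; first exact: measurable_itv.
apply: open_continuous_measurable_fun; first exact: interval_open.
by move=> x; rewrite inE/= in_itv/= => x1; exact: continuous_acos.
Qed.

(** Measurability is given only for [f] composed with cosines; composing with arccosines recovers
    [f] on the open square, and indicators restore the value [0] elsewhere. *)
Lemma measurable_on_square : measurable_fun setT (uncurry2 (on_square f)).
Proof.
pose a (z : plane R) : plane R := (via_acos id z.1, via_acos id z.2).
have ma : measurable_fun setT a.
  apply/measurable_fun_pairP; split.
    exact: (measurableT_comp measurable_via_acos_id measurable_fst).
  exact: (measurableT_comp measurable_via_acos_id measurable_snd).
have mT : measurable_fun setT (fc \_ Th).
  by apply: (measurable_restrictT _ _).1 => //.
have -> : uncurry2 (on_square f) = (fun z => (\1_U11 z.1 * \1_U11 z.2) * (fc \_ Th) (a z)).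
  apply/funext => z; rewrite /uncurry2 /on_square !indicE.
  have iE (x : R) : (x \in U11) = (-1 < x < 1).
    by apply/idP/idP; rewrite inE/= in_itv.
  rewrite !iE; case: ifPn => [/andP[z1 z2]|].
    rewrite z1 z2 !mul1r patchE ifT.
      rewrite /fc /a /via_acos /= z1 z2 !acosK// in_itv/=.
        by case/andP: z2 => ? ?; rewrite !ltW.
      by case/andP: z1 => ? ?; rewrite !ltW.
    rewrite inE /Th /a /via_acos /theta_domain/= z1 z2 !in_itv/=.
    by split; apply/andP; split; rewrite ltW//; have /andP[] := acos_0pi z1; have /andP[] := acos_0pi z2.
  by rewrite negb_and => /orP[/negbTE->|/negbTE->]; rewrite ?mul0r ?mulr0 ?mul0r.
apply: measurable_funM; last exact: (measurableT_comp mT ma).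
apply: measurable_funM.
  exact: (measurableT_comp (@measurable_indicU11 R) measurable_fst).
exact: (measurableT_comp (@measurable_indicU11 R) measurable_snd).
Qed.

Let sq_indic (z : plane R) (r : R) :
  uncurry2 (on_square f) z * r = uncurry2 (on_square f) z * r * (\1_U11 z.1 * \1_U11 z.2).
Proof.
rewrite /uncurry2 /on_square; case: ifPn => [/andP[z1 z2]|_]; last by rewrite !mul0r.
by rewrite !indicE !mem_set ?mulr1//= in_itv.
Qed.

Let sq_cos2 (z : plane R) : 0 < z.1 < pi -> 0 < z.2 < pi ->
  uncurry2 (on_square f) (cos2 z) = fc z.
Proof. by move=> z1 z2; rewrite /uncurry2 /on_square /= !cos_0pi. Qed.

(** The Jacobian [sin z.1 * sin z.2] is at most [1], so integrability in the angles passes to the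
    square. *)
Lemma integrable_on_square : J.-integrable setT (EFin \o uncurry2 (on_square f)).
Proof.
apply/integrableP; split; first by apply/measurable_EFinP; exact: measurable_on_square.
have /integrableP[_ fin] := ifc; apply: le_lt_trans fin.
have E z : (`|(EFin \o uncurry2 (on_square f)) z| =
   (`|uncurry2 (on_square f) z|)%:E * (\1_U11 z.1 * \1_U11 z.2)%:E)%E.
  have w0 : 0 <= \1_U11 z.1 * \1_U11 z.2 :> R by rewrite mulr_ge0.
  rewrite -EFinM; congr EFin; rewrite -{1}[uncurry2 _ z]mulr1 sq_indic mulr1 normrM.
  by rewrite (ger0_norm w0).
under eq_integral do rewrite E.
rewrite (ge0_cos_substitution2 (H := fun z => (`|uncurry2 (on_square f) z|)%:E)) //; last first.
  apply/measurable_EFinP; apply: measurableT_comp => //; exact: measurable_on_square.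
rewrite [leRHS]integral_mkcond; apply: ge0_le_integral => //.
- by move=> z _; rewrite mule_ge0// lee_fin mulr_ge0// sin0pi_ge0.
- apply: emeasurable_funM.
    apply/measurable_EFinP; apply: measurableT_comp => //.
    exact: measurableT_comp measurable_on_square (@measurable_cos2 R).
  apply/measurable_EFinP/measurable_funM.
    exact: (measurableT_comp (@measurable_sin0pi R) measurable_fst).
  exact: (measurableT_comp (@measurable_sin0pi R) measurable_snd).
- apply: (measurable_restrictT _ _).1 => //.
  by apply/measurable_EFinP; apply: measurableT_comp.
- move=> z _; rewrite /sin0pi patchE.
  have [z1|z1] := boolP (0 < z.1 < pi); last first.
    by rewrite mul0r mule0; case: ifPn.
  have [z2|z2] := boolP (0 < z.2 < pi); last first.
    by rewrite mulr0 mule0; case: ifPn.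
  rewrite sq_cos2// ifT; last first.
    rewrite inE /theta_domain/= !in_itv/=.
    by case/andP: z1 => ? ?; case/andP: z2 => ? ?; rewrite !ltW.
  rewrite -EFinM lee_fin ler_piMr// mulr_ile1 ?sin_le1// ltW// sin_gt0_pi//.
Qed.

(** The Jacobian cancels the sines in the denominators of the last derivatives, and their signs
    [(-1)^(k+1)] and [(-1)^(l+1)] combine to [(-1)^(k+l)]. *)
Lemma on_square_test_integral k l i j N N' :
  \int[J]_z (uncurry2 (on_square f) z *
    tens (via_acos (cheb_test k i N k.+1)) (via_acos (cheb_test l j N' l.+1)) z) =
  (-1) ^+ (k + l) * (I i j - I (i + 2 * N) j - (I i (j + 2 * N') - I (i + 2 * N) (j + 2 * N'))).
Proof.
set s : R := (-1) ^+ (k + l).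
set A := via_acos _; set B := via_acos _.
pose D1 := fun th : R => cos (i%:R * th) - cos ((i + 2 * N)%:R * th).
pose D2 := fun th : R => cos (j%:R * th) - cos ((j + 2 * N')%:R * th).
have D1_0 (th : R) : sin th = 0 -> D1 th = 0.
  by move=> s0; apply/eqP; rewrite -normr_le0 (le_trans (cos_diff_le _ _ _))// s0 normr0 !mulr0.
have D2_0 (th : R) : sin th = 0 -> D2 th = 0.
  by move=> s0; apply/eqP; rewrite -normr_le0 (le_trans (cos_diff_le _ _ _))// s0 normr0 !mulr0.
have mA : measurable_fun setT A.
  by apply: continuous_measurable_fun; exact: continuous_cheb_test.
have mB : measurable_fun setT B.
  by apply: continuous_measurable_fun; exact: continuous_cheb_test.
have iB1 : J.-integrable Th (EFin \o (fun z => ci i j z - ci (i + 2 * N) j z)).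
  exact: (integrableB mTh (ici _ _) (ici _ _)).
have iB2 : J.-integrable Th (EFin \o (fun z => ci i (j + 2 * N') z - ci (i + 2 * N) (j + 2 * N') z)).
  exact: (integrableB mTh (ici _ _) (ici _ _)).
rewrite /I -!RintegralB//= -RintegralZl//; last exact: (integrableB mTh iB1 iB2).
rewrite [RHS]Rintegral_mkcond; congr fine.
transitivity (\int[J]_z ((uncurry2 (on_square f) z * tens A B z) * (\1_U11 z.1 * \1_U11 z.2))%:E)%E.
  by apply: eq_integral => z _; rewrite -sq_indic.
rewrite cos_substitution2; last first.
  apply: measurable_funM; first exact: measurable_on_square.
  apply: measurable_funM.
    exact: measurableT_comp mA measurable_fst.
  exact: measurableT_comp mB measurable_snd.
apply: eq_integral => z _; congr EFin; rewrite patchE.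
have -> : s * (ci i j z - ci (i + 2 * N) j z - (ci i (j + 2 * N') z - ci (i + 2 * N) (j + 2 * N') z)) =
   s * fc z * D1 z.1 * D2 z.2 by rewrite !ciE /D1 /D2; ring.
(* The closed square of angles exceeds the open one only where a sine vanishes, and there the
   corresponding cosine difference vanishes too. *)
have edge (th : R) : ~~ (0 < th < pi) -> 0 <= th <= pi -> sin th = 0.
  move=> h /andP[t0 t1]; move: h; rewrite negb_and -!leNgt => /orP[h|h].
    by have -> : th = 0; [apply/eqP; rewrite eq_le h|exact: sin0].
  by have -> : th = pi; [apply/eqP; rewrite eq_le t1|exact: sinpi].
rewrite /sin0pi.
have [z1|z1] := boolP (0 < z.1 < pi); last first.
  rewrite mul0r mulr0; case: ifPn => //; rewrite inE /theta_domain/= !in_itv/= => -[t1 _].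
  by rewrite D1_0 ?mulr0 ?mul0r//; exact: edge.
have [z2|z2] := boolP (0 < z.2 < pi); last first.
  rewrite !mulr0; case: ifPn => //; rewrite inE /theta_domain/= !in_itv/= => -[_ t1].
  by rewrite (D2_0 z.2) ?mulr0//; exact: edge.
rewrite ifT; last first.
  rewrite inE /theta_domain/= !in_itv/=.
  by case/andP: z1 => ? ?; case/andP: z2 => ? ?; rewrite !ltW.
have s1 : sin z.1 != 0 by rewrite gt_eqF// sin_gt0_pi.
have s2 : sin z.2 != 0 by rewrite gt_eqF// sin_gt0_pi.
have K1 : acos (cos z.1) = z.1 by rewrite cosK// in_itv/=; case/andP: z1 => ? ?; rewrite !ltW.
have K2 : acos (cos z.2) = z.2 by rewrite cosK// in_itv/=; case/andP: z2 => ? ?; rewrite !ltW.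
rewrite sq_cos2// /tens /A /B /via_acos /= !cos_0pi// K1 K2 /cheb_test !ltnn.
rewrite -/(D1 z.1) -/(D2 z.2) /s exprD !exprS; field.
by rewrite s1 s2.
Qed.

End ChebyshevCoefficients.

Section CosineMeanIntegral.
Variable R : realType.
Notation leb := (@lebesgue_measure R).
Notation J := (leb \x leb)%E.
Local Notation Th := (@theta_domain R).
Variables (pr : plane R -> R) (g : plane R -> R).
Hypothesis mpr : measurable_fun setT pr.
Hypothesis pr0 : J.-negligible [set z | Th z /\ sin (pr z) = 0].
Hypothesis ig : J.-integrable Th (EFin \o g).

Let mg : measurable_fun Th g.
Proof. by apply/measurable_EFinP; exact: measurable_int ig. Qed.

Let integrable_mul_le (h : R -> R) (C : R) : measurable_fun setT h ->
  (forall t, `|h t| <= C) -> J.-integrable Th (EFin \o (fun z => g z * h (pr z))).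
Proof.
move=> mh hC; have mTh := @measurable_theta_domain R.
have mhp : measurable_fun Th (fun z => h (pr z)).
  by apply: measurable_funTS; exact: measurableT_comp mh mpr.
apply: (le_integrable mTh _ _ (integrableZl mTh C ig)).
  by apply/measurable_EFinP; exact: measurable_funM.
move=> z _ /=; rewrite lee_fin !normrM mulrC ler_wpM2r//.
exact: le_trans (hC _) (ler_norm _).
Qed.

Let sum_integral i n :
  \sum_(0 <= m < n) (\int[J]_(z in Th) (g z * cos ((i + 2 * m)%:R * pr z))) =
  \int[J]_(z in Th) (g z * \sum_(0 <= m < n) cos ((i + 2 * m)%:R * pr z)).
Proof.
have mTh := @measurable_theta_domain R.
elim: n => [|n IH].
  rewrite big_geq//; apply/esym.
  under eq_Rintegral do rewrite big_geq// mulr0.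
  by rewrite Rintegral_cst// mul0r.
rewrite big_nat_recr//= IH -RintegralD//.
- by apply: eq_Rintegral => z _; rewrite big_nat_recr//= mulrDr.
- apply: (integrable_mul_le (h := fun t => \sum_(0 <= m < n) cos ((i + 2 * m)%:R * t)) (C := n%:R)).
    by apply: measurable_sum => m; exact: measurable_cosM.
  move=> t; apply: le_trans (ler_norm_sum _ _ _) _.
  have -> : n%:R = \sum_(0 <= m < n) (1 : R) by rewrite sumr_const_nat subn0.
  by apply: ler_sum => m _; rewrite ler_norml cos_geN1 cos_le1.
- apply: (integrable_mul_le (h := fun t => cos ((i + 2 * n)%:R * t)) (C := 1)).
    exact: measurable_cosM.
  by move=> t; rewrite ler_norml cos_geN1 cos_le1.
Qed.

Lemma cos_mean_integral_cvg i :
  arithmetic_mean (fun m => \int[J]_(z in Th) (g z * cos ((i + 2 * m)%:R * pr z)))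
    @ \oo --> (0 : R).
Proof.
have mTh := @measurable_theta_domain R.
have mcm n : measurable_fun setT (fun t : R => cos_mean i n t).
  apply: measurable_funM; first exact: measurable_cst.
  by apply: measurable_sum => m; exact: measurable_cosM.
have icm n : J.-integrable Th (EFin \o (fun z => g z * cos_mean i n (pr z))).
  exact: (integrable_mul_le (mcm n) (cos_mean_le1 i n)).
have -> : arithmetic_mean (fun m => \int[J]_(z in Th) (g z * cos ((i + 2 * m)%:R * pr z))) =
    (fun n => \int[J]_(z in Th) (g z * cos_mean i n (pr z))).
  apply/funext => n; rewrite /arithmetic_mean /series /= sum_integral -RintegralZl//.
    by apply: eq_Rintegral => z _; rewrite mulrCA.
  apply: (integrable_mul_le (h := fun t => \sum_(0 <= m < n.+1) cos ((i + 2 * m)%:R * t)) (C := n.+1%:R)).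
    by apply: measurable_sum => m; exact: measurable_cosM.
  move=> t; have := cos_mean_le1 i n t.
  by rewrite normrM normfV normr_nat mulrC ler_pdivrMr// mul1r.
have [|||||_ _ h2] := @dominated_convergence _ _ _ J Th mTh
    (fun n => EFin \o (fun z => g z * cos_mean i n (pr z))) (cst 0%E) (fun z => `|g z|%:E).
- by move=> n; exact: measurable_int (icm n).
- exact: measurable_cst.
- apply: negligibleS pr0 => z /= /not_implyP[Tz nz]; split=> //.
  apply: contrapT => /eqP s0; apply: nz; apply: cvg_EFin; first exact: nearW.
  by rewrite -(mulr0 (g z)); apply: cvgMr; exact: cos_mean_cvg.
- exact: (integrable_abse ig).
- apply: aeW => z n Dz /=; rewrite lee_fin normrM ler_piMr// cos_mean_le1//.
move: h2; rewrite integral0 => h2; apply: fine_cvg; exact: h2.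
Qed.

End CosineMeanIntegral.

Lemma sin_eq0_0pi (R : realType) (t : R) : 0 <= t <= pi -> sin t = 0 -> t = 0 \/ t = pi.
Proof.
move=> /andP[t0 t1] s0; have [->|tn0] := eqVneq t 0; first by left.
right; apply/eqP; rewrite eq_le t1 /= leNgt; apply/negP => tpi.
have : 0 < sin t by apply: sin_gt0_pi; rewrite // lt_def tn0 t0.
by rewrite s0 ltxx.
Qed.

Section CoefficientMeans.
Variable R : realType.
Notation leb := (@lebesgue_measure R).
Notation J := (leb \x leb)%E.
Local Notation Th := (@theta_domain R).

Let leb_edges : leb (([set 0] `|` [set pi]) : set (measurableTypeR R)) = 0%E.
Proof.
exact: countable_lebesgue_measure0 (finite_set_countable (finite_set2 0 pi)).
Qed.

Let medges : measurable (([set 0] `|` [set pi]) : set (measurableTypeR R)).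
Proof. by apply: measurableU; exact: measurable_set1. Qed.

Lemma negligible_edges1 : J.-negligible [set z : plane R | Th z /\ sin z.1 = 0].
Proof.
exists (([set 0] `|` [set pi]) `*` setT); split.
- exact: measurableX.
- by rewrite product_measure1E//= leb_edges mul0e.
- move=> z [[/= z1 _] s0]; split=> //=; rewrite in_itv/= in z1.
  exact: sin_eq0_0pi.
Qed.

Lemma negligible_edges2 : J.-negligible [set z : plane R | Th z /\ sin z.2 = 0].
Proof.
exists (setT `*` ([set 0] `|` [set pi])); split.
- exact: measurableX.
- by rewrite product_measure1E//= leb_edges mule0.
- move=> z [[_ /= z2] s0]; split=> //=; rewrite in_itv/= in z2.
  exact: sin_eq0_0pi.
Qed.

Variable f : R -> R -> R.
Hypothesis exf : forall i j, cheb_coef_exists f 0 0 i j.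
Let I i j := \int[J]_(z in Th) cheb_integrand f 0 0 i j z.

Lemma cheb_mean_cvg1 i j : arithmetic_mean (fun m => I (i + 2 * m) j) @ \oo --> (0 : R).
Proof.
(* Frequency [0] in the averaged variable leaves [f] times the other cosine, the fixed integrable
   factor [g]. *)
have := exf 0 j.
rewrite /cheb_coef_exists (_ : _ \o _ = EFin \o (fun z : plane R => f (cos z.1) (cos z.2) * cos (j%:R * z.2))); last first.
  by apply/funext => z; rewrite /cheb_integrand /= mul0r cos0 mulr1.
move=> /(@cos_mean_integral_cvg R fst _ measurable_fst negligible_edges1)/(_ i).
under [X in arithmetic_mean X]eq_fun do under eq_Rintegral do rewrite mulrAC.
by [].
Qed.

Lemma cheb_mean_cvg2 i j : arithmetic_mean (fun m => I i (j + 2 * m)) @ \oo --> (0 : R).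
Proof.
have := exf i 0.
rewrite /cheb_coef_exists (_ : _ \o _ = EFin \o (fun z : plane R => f (cos z.1) (cos z.2) * cos (i%:R * z.1))); last first.
  by apply/funext => z; rewrite /cheb_integrand /= mul0r cos0 mulr1.
by move=> /(@cos_mean_integral_cvg R snd _ measurable_snd negligible_edges2)/(_ j).
Qed.

End CoefficientMeans.

Section Averaging.
Variable R : realType.

(** Only the means of [u] are known to vanish, so the inequality itself is averaged; by Cesaro the
    means of [b] keep the limit [B]. *)
Lemma arithmetic_mean_le (x B : R) (u b : nat -> R) :
  (forall n, `|x - u n| <= b n) -> b @ \oo --> B ->
  arithmetic_mean u @ \oo --> (0 : R) -> `|x| <= B.
Proof.
move=> xub /cesaro bB u0.
have xu : `|x - arithmetic_mean u n| @[n --> \oo] --> `|x|.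
  by apply: cvg_norm; rewrite -[X in _ --> X]subr0; apply: cvgB => //; exact: cvg_cst.
apply: (ler_cvg_to xu bB); apply: nearW => n; rewrite /arithmetic_mean /series /=.
have -> : x = n.+1%:R^-1 * \sum_(0 <= k < n.+1) x.
  by rewrite sumr_const_nat subn0 -[x *+ _]mulr_natl mulrA mulVf ?mul1r.
rewrite -mulrBr -sumrB normrM normfV normr_nat ler_wpM2l ?invr_ge0//.
by apply: le_trans (ler_norm_sum _ _ _) _; apply: ler_sum => k _.
Qed.

(** The first factor of the product is at least [n + 1], the others at least [1]. *)
Lemma gam_le_inv k n m : (k + n < m)%N -> gam k m%:R <= n.+1%:R^-1 :> R.
Proof.
move=> knm; have km : (k < m)%N by apply: leq_ltn_trans knm; exact: leq_addr.
have e : n.+1%:R <= m%:R - k%:R :> R by rewrite lerBrDr -natrD ler_nat addnC addnS.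
rewrite /gam lef_pV2 ?posrE//; last by have := gam_gt0 R km; rewrite /gam invr_gt0.
rewrite big_ord_recl mulr0 addr0 -[leLHS]mulr1; apply: ler_pM => //.
apply: (big_ind (fun y : R => 1 <= y)) => //; first exact: mulr_ege1.
move=> i _; rewrite (le_trans _ (lerD e (_ : 0 <= 2 * (lift ord0 i)%:R)))//.
by rewrite addr0 ler1n.
Qed.

Lemma gam_shift_cvg k i : (k < i)%N -> gam k (i + 2 * N)%:R @[N --> \oo] --> (0 : R).
Proof.
move=> ki.
have c : (1 / N.+1%:R) @[N --> \oo] --> (0 : R) := cvg_step _.
apply: (squeeze_cvgr _ (cvg_cst 0) c); apply: nearW => N.
rewrite ltW ?gam_gt0 ?ltn_addr//= div1r gam_le_inv// mul2n -addnn addnA.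
by rewrite (leq_trans (_ : _ <= i + N)%N) ?leq_addr// -addSn leq_add2r.
Qed.

Lemma Gamma00 s (x : R) : Gamma 0 0 s x = gam (2 * s) x.
Proof.
rewrite /Gamma /gam addn0 big_mkord; congr (_^-1); apply: eq_bigr => m _.
by rewrite rmorphB/= natrM mulr0z -!pmulrn; ring.
Qed.

(** Factor by factor, [x + 2 (m - s) - 1 = x - (2 s + 1) + 2 m]. *)
Lemma Gamma1N1 s (x : R) : Gamma 1 (-1) s x = gam (2 * s + 1) x.
Proof.
rewrite /Gamma /gam big_mkord; congr (_^-1); apply: eq_bigr => m _.
by rewrite rmorphB/= natrD natrM rmorphN1 -!pmulrn; ring.
Qed.

End Averaging.

(** * From four coefficients to one *)

Section CoefficientBound.
Variable R : realType.
Notation leb := (@lebesgue_measure R).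
Notation J := (leb \x leb)%E.
Local Notation Th := (@theta_domain R).
Variables (f : R -> R -> R) (k l : nat).
Variables (mu : {charge set (plane R) -> \bar R}) (P N : set (plane R)).
Variable muPN : hahn_decomposition mu P N.
Hypothesis ex_partial : partial_exists f k l.
Hypothesis vbv : vitali_bounded_variation (partial f k l).
Hypothesis mu_charge : is_stieltjes_charge (partial f k l) mu.
Hypothesis exf : forall i j, cheb_coef_exists f 0 0 i j.

Let I i j := \int[J]_(z in Th) cheb_integrand f 0 0 i j z.
Let v := fine (square_variation muPN setT).

Lemma four_coefficients_le i j n m : (k < i)%N -> (l < j)%N ->
  `|I i j - I (i + 2 * n) j - (I i (j + 2 * m) - I (i + 2 * n) (j + 2 * m))| <=
  (gam k i%:R + gam k (i + 2 * n)%:R) * (gam l j%:R + gam l (j + 2 * m)%:R) * v.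
Proof.
move=> ki lj; have [M HM] := vitali_increment_le vbv.
have H := @core_inequality_closed R M k l (fun q => on_square (partial f 0 q))
  (fun p => on_square (partial f p l)) (square_variation muPN)
  (fun x x' y y' => fine (mu (`]x, x'] `*` `]y, y']))).
have := @on_square_test_integral R f exf k l i j n m.
move=> /(congr1 Num.norm); rewrite normrM normrX normrN1 expr1n mul1r => <-.
change (on_square f) with (on_square (partial f 0 0)).
have {}H := fun h1 h2 h3 h4 h5 h6 h7 =>
  H h1 h2 h3 h4 h5 h6 h7 _ _ _ _ (test_cheb R n ki) (test_cheb R m lj) (fun x => cheb_test_le n x ki)
    (fun x => cheb_test_le m x lj).
apply: H.
- by move=> x x1; exact: (chain_on_square2 ex_partial).
- by move=> y y1; exact: (chain_on_square1 ex_partial).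
- by [].
- exact: integrable_on_square.
- move=> x x' y y' x1 x2 x3 y1 y2 y3; rewrite /increment /on_square.
  have -> : -1 < x < 1 by lra.
  have -> : -1 < x' < 1 by lra.
  have -> : -1 < y < 1 by lra.
  have -> : -1 < y' < 1 by lra.
  exact: HM.
- exact: (stieltjes_increment_cvg mu_charge).
- exact: charge_cell_le.
Qed.

Lemma cheb_integral_le i j : (k < i)%N -> (l < j)%N ->
  `|I i j| <= gam k i%:R * gam l j%:R * v.
Proof.
move=> ki lj.
(* Averaging over [n] at fixed [m] removes both coefficients of first index [i + 2 n] at once. *)
have lim1 m : `|I i j - I i (j + 2 * m)| <=
    gam k i%:R * (gam l j%:R + gam l (j + 2 * m)%:R) * v.
  apply: (@arithmetic_mean_le _ _ _ (fun n => I (i + 2 * n) j - I (i + 2 * n) (j + 2 * m))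
    (fun n => (gam k i%:R + gam k (i + 2 * n)%:R) * (gam l j%:R + gam l (j + 2 * m)%:R) * v)).
  - move=> n; apply: le_trans (four_coefficients_le n m ki lj).
    by rewrite le_eqVlt; apply/orP; left; apply/eqP; congr `|_|; ring.
  - do 2 apply: cvgMl; rewrite -[X in _ --> X]addr0; apply: cvgD; first exact: cvg_cst.
    exact: gam_shift_cvg.
  - rewrite -[X in _ --> X](subrr 0).
    apply: cvg_trans (cvgB (cheb_mean_cvg1 exf i j) (cheb_mean_cvg1 exf i (j + 2 * m))).
    apply: near_eq_cvg; apply: nearW => n.
    by rewrite /arithmetic_mean /series /= sumrB mulrBr.
apply: (arithmetic_mean_le lim1); last exact: cheb_mean_cvg2.
apply: cvgMl; apply: cvgMr; rewrite -[X in _ --> X]addr0; apply: cvgD; first exact: cvg_cst.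
exact: gam_shift_cvg.
Qed.

End CoefficientBound.

Unset Implicit Arguments.
Set Strict Implicit.
Set Printing Implicit Defensive.

Theorem theorem3p1 (R : realType) (f : R -> R -> R) (k l : nat)
    (mu : {charge set (plane R) -> \bar R}) (P N : set (plane R))
    (muPN : hahn_decomposition mu P N) :
  partial_exists f k l ->
  vitali_bounded_variation (partial f k l) ->
  is_stieltjes_charge (partial f k l) mu ->
  (forall i j : nat, cheb_coef_exists f 0 0 i j) ->
  (forall i j : nat, stieltjes_coef_exists muPN i j) ->
  (weighted_variation muPN < +oo)%E ->
  let V := fine (weighted_variation muPN) in
  forall i j : nat, (k + 1 <= i)%N -> (l + 1 <= j)%N ->
  forall s r : nat,
  [/\ k = (2 * s)%N -> l = (2 * r)%N ->
        `|cheb_coef f 0 0 i j| <=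
          4 * V / pi ^+ 2 * (Gamma 0 0 s i%:R * Gamma 0 0 r j%:R),
      k = (2 * s)%N -> l = (2 * r + 1)%N ->
        `|cheb_coef f 0 0 i j| <=
          4 * V / pi ^+ 2 * (Gamma 0 0 s i%:R * Gamma 1 (-1) r j%:R),
      k = (2 * s + 1)%N -> l = (2 * r)%N ->
        `|cheb_coef f 0 0 i j| <=
          4 * V / pi ^+ 2 * (Gamma 1 (-1) s i%:R * Gamma 0 0 r j%:R)
    & k = (2 * s + 1)%N -> l = (2 * r + 1)%N ->
        `|cheb_coef f 0 0 i j| <=
          4 * V / pi ^+ 2 * (Gamma 1 (-1) s i%:R * Gamma 1 (-1) r j%:R)].
Proof.
move=> ex_partial vbv mu_charge exf exc Vlt V i j.
rewrite !addn1 => ki lj s r.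
have nuV : fine (square_variation muPN setT) <= V.
  have := charge_variation_le_weighted (exc 0 0).
  rewrite /square_variation /= /mfrestr /mrestr setTI => h.
  rewrite /V fine_le//; first by rewrite fin_num_measure//; exact: measurable_Dsquare.
  by rewrite ge0_fin_numE// (le_trans _ h).
have main : `|cheb_coef f 0 0 i j| <= 4 * V / pi ^+ 2 * (gam k i%:R * gam l j%:R).
  have p0 : 0 <= 4 / pi ^+ 2 :> R by rewrite divr_ge0 ?sqr_ge0.
  rewrite /cheb_coef normrM ger0_norm// [4 * V / _]mulrAC -[leRHS]mulrA ler_wpM2l//.
  apply: le_trans (cheb_integral_le muPN ex_partial vbv mu_charge exf ki lj) _.
  by rewrite mulrC ler_wpM2r// mulr_ge0// ltW// gam_gt0.
by split=> kE lE; rewrite ?Gamma00 ?Gamma1N1 -kE -lE.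
Qed.
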